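(* Real sextet zeros of hexagonal systems are dense in the interval $(-\infty,0]$. That is, the set of real numbers $r$ for which there exists a hexagonal system $H$ (with at least one perfect matching) whose sextet polynomial satisfies $\sigma(H,r)=0$ is dense in $(-\infty,0]$.
   Context: A hexagonal system is a finite connected plane graph without cut vertices in which every interior face is bounded by a regular hexagon of side length $1$; its hexagons are its interior faces. Let $H$ be a hexagonal system with at least one perfect matching (Kekulé structure). A Clar cover of $H$ is a spanning subgraph of $H$ each connected component of which is either a hexagon or an edge. A resonant pattern of $H$ is the set of hexagons of a Clar cover of $H$. The Clar number $C(H)$ is the maximum number of hexagons in a resonant pattern. The sextet polynomial of $H$ is $\sigma(H,x)=\sum_{k=0}^{C(H)}s(H,k)x^k$, where $s(H,k)$ is the number of resonant patterns of $H$ with exactly $k$ hexagons and $s(H,0)=1$. A number $r$ is called a sextet zero if it is a zero of the sextet polynomial of some hexagonal system. *)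

(* Defs.v *)
From HB Require Import structures.
From mathcomp Require Import all_boot all_order all_algebra.

Set Implicit Arguments.
Unset Strict Implicit.
Unset Printing Implicit Defensive.

Import Order.TTheory GRing.Theory Num.Theory.

Local Open Scope ring_scope.

(* A spanning subgraph of a simple graph on [T] is given by its set [F] of
   edges, an edge being the two-element set of its ends. *)

Definition edges (T : finType) (adj : rel T) : {set {set T}} :=
  [set [set xy.1; xy.2] | xy : T * T & adj xy.1 xy.2].

Definition edge_rel (T : finType) (F : {set {set T}}) : rel T :=
  [rel x y | [set x; y] \in F].

(* The edges of the component of [x] in the spanning subgraph [F]; this is
   empty exactly when [x] is isolated in [F]. *)
Definition component_edges (T : finType) (F : {set {set T}}) (x : T) :
    {set {set T}} :=
  [set e in F | e \subset [set y | connect (edge_rel F) x y]].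

Definition perfect_matching (T : finType) (adj : rel T) (M : {set {set T}}) :
    bool :=
  (M \subset edges adj) && [forall x, #|[set e in M | x \in e]| == 1%N].

(* [hexs] is the set of hexagons, each represented by its set of six edges.
   A component without isolated vertices is determined by its edges, so the
   components that are edges are those with exactly one edge. *)
Definition clar_cover (T : finType) (adj : rel T)
    (hexs : {set {set {set T}}}) (F : {set {set T}}) : bool :=
  (F \subset edges adj) &&
  [forall x, (component_edges F x \in hexs) || (#|component_edges F x| == 1%N)].

Definition cover_hexagons (T : finType) (hexs : {set {set {set T}}})
    (F : {set {set T}}) : {set {set {set T}}} :=
  [set component_edges F x | x : T] :&: hexs.

Definition resonant_pattern (T : finType) (adj : rel T)
    (hexs : {set {set {set T}}}) (P : {set {set {set T}}}) : bool :=
  [exists F, clar_cover adj hexs F && (P == cover_hexagons hexs F)].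

Definition clar_number_of (T : finType) (adj : rel T)
    (hexs : {set {set {set T}}}) : nat :=
  \max_(P | resonant_pattern adj hexs P) #|P|.

Definition resonant_count (T : finType) (adj : rel T)
    (hexs : {set {set {set T}}}) (k : nat) : nat :=
  #|[set P | resonant_pattern adj hexs P & #|P| == k]|.

Definition connected_graph (T : finType) (adj : rel T) : Prop :=
  (0 < #|T|)%N /\ forall x y : T, connect adj x y.

Definition delete_vertex (T : finType) (adj : rel T) (v : T) : rel T :=
  [rel x y | [&& x != v, y != v & adj x y]].

Definition cut_vertex (T : finType) (adj : rel T) (v : T) : Prop :=
  exists x y : T, [/\ x != v, y != v, connect adj x y &
    ~~ connect (delete_vertex adj v) x y].

From mathcomp Require Import all_classical all_reals all_analysis.
Import numFieldNormedType.Exports.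

Local Open Scope classical_set_scope.

Definition plane_segment (R : realType) (p q : R * R) : set (R * R) :=
  [set ((1 - t) * p.1 + t * q.1, (1 - t) * p.2 + t * q.2) | t in `[0, 1]].

Definition plane_arc (R : realType) (p q : R * R) (A : set (R * R)) : Prop :=
  exists f : R -> R * R,
    [/\ {within `[0, 1], continuous f}, {in `[0, 1] &, injective f},
        f 0 = p, f 1 = q & A = f @` `[0, 1]].

(* [curve x y] is only meaningful when [adj x y] holds. *)
Record plane_graph (R : realType) := PlaneGraph {
  vertex :> finType;
  adj : rel vertex;
  position : vertex -> R * R;
  curve : vertex -> vertex -> set (R * R);
  adj_sym : symmetric adj;
  adj_irr : irreflexive adj;
  position_inj : injective position;
  curve_sym : forall x y, adj x y -> curve x y = curve y x;
  curve_arc : forall x y, adj x y ->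
    plane_arc (position x) (position y) (curve x y);
  curve_vertex : forall x y z, adj x y ->
    ~ (curve x y `\` [set position x; position y]) (position z);
  curve_disjoint : forall x y z w, adj x y -> adj z w ->
    ([set x; y] <> [set z; w])%SET ->
    (curve x y `\` [set position x; position y]) `&` curve z w = set0
}.

Definition drawing (R : realType) (H : plane_graph R) : set (R * R) :=
  range (@position R H) `|`
  [set p | exists x y : H, adj x y /\ curve x y p].

Definition face (R : realType) (H : plane_graph R) (F : set (R * R)) : Prop :=
  exists2 p, (~` drawing H) p & F = connected_component (~` drawing H) p.

Definition interior_face (R : realType) (H : plane_graph R)
    (F : set (R * R)) : Prop :=
  face H F /\ bounded_set F.

Definition frontier (R : realType) (F : set (R * R)) : set (R * R) :=
  closure F `\` F°.

(* The vertices [v 0, ..., v 5] and the edges joining cyclically consecutive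
   ones form a regular hexagon, listed counterclockwise, with center [c] and
   circumradius 1, i.e. with side length 1. *)
Definition regular_unit_hexagon (R : realType) (H : plane_graph R)
    (v : 'I_6 -> H) : Prop :=
  exists (c : R * R) (theta : R), forall k : 'I_6,
    [/\ position (v k) = (c.1 + cos (theta + k%:R * (pi / 3)),
                          c.2 + sin (theta + k%:R * (pi / 3))),
        adj (v k) (v (ordS k)) &
        curve (v k) (v (ordS k)) =
          plane_segment (position (v k)) (position (v (ordS k)))].

Definition bounded_by (R : realType) (H : plane_graph R)
    (F : set (R * R)) (v : 'I_6 -> H) : Prop :=
  regular_unit_hexagon v /\
  frontier F = \bigcup_(k in [set: 'I_6]) curve (v k) (v (ordS k)).

Definition hexagonal_system (R : realType) (H : plane_graph R) : Prop :=
  [/\ connected_graph (@adj R H),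
      forall v : H, ~ cut_vertex (@adj R H) v &
      forall F, interior_face H F -> exists v : 'I_6 -> H, bounded_by F v].

Definition hexagon_edges (R : realType) (H : plane_graph R) (v : 'I_6 -> H) :
    {set {set H}} :=
  [set [set v k; v (ordS k)] | k : 'I_6]%SET.

Definition hexagons (R : realType) (H : plane_graph R) :
    {set {set {set H}}} :=
  [set h : {set {set H}} | `[< exists (F : set (R * R)) (v : 'I_6 -> H),
    [/\ interior_face H F, bounded_by F v & h = hexagon_edges v] >]]%SET.

Definition clar_number (R : realType) (H : plane_graph R) : nat :=
  clar_number_of (@adj R H) (hexagons H).

Definition sextet_polynomial (R : realType) (H : plane_graph R) : {poly R} :=
  \sum_(k < (clar_number H).+1)
    (resonant_count (@adj R H) (hexagons H) k)%:R *: 'X^k.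

Definition sextet_zero (R : realType) (r : R) : Prop :=
  exists H : plane_graph R,
    [/\ hexagonal_system H,
        exists M, perfect_matching (@adj R H) M &
        (sextet_polynomial H).[r] = 0].

(* Main.v *)
Require Import Defs.
From mathcomp Require Import all_boot all_order all_algebra.
From mathcomp Require Import zify ring lra.
Set Implicit Arguments.
Unset Strict Implicit.
Unset Printing Implicit Defensive.

(** The zeros come from hexagonal chains that turn at every [m+1]-st hexagon.

    In a chain, call a hexagon a kink when the chain turns there. Walking
    along the chain from left to right, a Clar cover is forced: once a
    hexagon is chosen, the rung it shares with the next hexagon is covered
    from the left, and this stays so through straight hexagons, which can
    therefore not be chosen; only a kink frees the chain again. Hence a set of
    hexagons is resonant exactly when a kink lies strictly between any two
    chosen hexagons ([chain_resonantP]), and the sextet polynomial obeys a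
    two-state recursion ([weights], [sum_resonant]). With [m] straight
    hexagons between consecutive kinks it becomes
    [A (n+2) = (1 + m x) A (n+1) + x A n], where [A n] is the sextet polynomial
    of the chain of [n (m+1) - 1] hexagons.

    For [x = - s^2] and [1 - m s^2 = 2 s cos th] the solution is
    [A n * sin th = s^n * sin ((n+1) th)] ([weights_sin]), so every angle
    [k pi / (n+1)] with [0 < k <= n] gives a zero. For every [s > 0] some [m]
    puts [(1 - m s^2) / (2 s)] strictly between -1 and 1, that is,
    every [s > 0] comes from an angle; as [s] depends continuously on the angle
    and the angles [k pi / (n+1)] are dense, so are the zeros
    ([weights_zeros_dense]).

    That these chains are hexagonal systems is proved in the triangular
    lattice. Hexagons are the cells [|u|, |v|, |u + v| <= 1] around lattice
    points of one class modulo 3, and a chain always advances to the right. An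
    interior point of a unit edge lies in the open cells of the two ends of
    that edge and of no other lattice point ([near_unit_edge]); this one fact
    shows that edges do not cross and do not enter the open hexagons. An open
    hexagon is then a component of the complement of the drawing, because
    it is convex and relatively clopen there. Any other point of the complement
    escapes to infinity along a vertical ray, since the chain meets each
    vertical line in an interval ([chain_escape]). So the bounded faces are
    the open hexagons ([chain_interior_faceP]). *)

(** * Clar covers as tilings *)

Section Tilings.
Variables (T : finType) (adj : rel T) (hexs : {set {set {set T}}}).
Implicit Types (x y z : T) (e : {set T}) (t F : {set {set T}}).
Implicit Types (P TT : {set {set {set T}}}).

Definition tile t : bool := (t \in hexs) || (#|t| == 1%N).

(** The tiles of [TT] have pairwise disjoint vertex sets whose union is [A].
    Tilings can be extended one tile at a time, which is hard to say in terms of the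
    connected components of a subgraph. *)
Definition tiles_vertices (A : {set T}) TT : Prop :=
  [/\ forall t, t \in TT -> tile t,
      forall t t' x, t \in TT -> t' \in TT -> x \in cover t -> x \in cover t' ->
        t = t' &
      forall x, (x \in A) = [exists t in TT, x \in cover t]].

Hypothesis adj_sym : symmetric adj.
Hypothesis adj_irr : irreflexive adj.

Lemma edgesP e :
  reflect (exists x y, adj x y /\ e = [set x; y]) (e \in edges adj).
Proof.
apply: (iffP imsetP) => [[[x y]]|[x [y [xy ->]]]].
  by rewrite inE /= => xy ->; exists x, y.
by exists (x, y); rewrite ?inE.
Qed.

Lemma edge_adj x y : ([set x; y] \in edges adj) = adj x y.
Proof.
apply/edgesP/idP => [[x' [y' [a E]]]|a]; last by exists x, y.
have ne : x' != y' by apply/eqP => xy; rewrite xy adj_irr in a.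
have /set2P[ex|ex] : x \in [set x'; y'] by rewrite -E set21.
- have /set2P[ey|ey] : y \in [set x'; y'] by rewrite -E set22.
    have /set2P[ey'|ey'] : y' \in [set x; y] by rewrite E set22.
      by rewrite -ex ey' eqxx in ne.
    by rewrite -ey ey' eqxx in ne.
  by rewrite ex ey.
- have /set2P[ey|ey] : y \in [set x'; y'] by rewrite -E set22.
    by rewrite ex ey adj_sym.
  have /set2P[ex'|ex'] : x' \in [set x; y] by rewrite E set21.
    by rewrite ex' ex eqxx in ne.
  by rewrite ex' ey eqxx in ne.
Qed.

Definition component F x : {set T} := [set y | connect (edge_rel F) x y].

Lemma edge_rel_sym F : symmetric (edge_rel F).
Proof. by move=> x y; rewrite /edge_rel /= setUC. Qed.

Lemma component_refl F x : x \in component F x.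
Proof. by rewrite inE connect0. Qed.

Lemma component_eq F x y : y \in component F x -> component F y = component F x.
Proof.
rewrite inE => xy; apply/setP => z; rewrite !inE; apply/idP/idP.
  exact: connect_trans.
by apply: connect_trans; rewrite (sym_connect_sym (edge_rel_sym F)).
Qed.

Lemma component_edgesE F x :
  component_edges F x = [set e in F | e \subset component F x].
Proof. by []. Qed.

Lemma edge_component F x y e : F \subset edges adj ->
  e \in F -> y \in e -> y \in component F x -> e \in component_edges F x.
Proof.
move=> /subsetP FE eF ye yx; rewrite inE eF /=; have /edgesP[u [v [_ E]]] := FE _ eF.
have uv : edge_rel F u v by rewrite /edge_rel /= -E.
have step w : w \in e -> edge_rel F y w || (w == y).
  move: ye; rewrite E !inE => /orP[]/eqP -> /orP[]/eqP ->; rewrite ?eqxx ?orbT ?uv //.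
  by rewrite (edge_rel_sym F v u) uv.
apply/subsetP => w /step /orP[yw|/eqP->//].
rewrite inE in yx; rewrite inE; apply: connect_trans yx _; exact: connect1.
Qed.

(** In a component that has an edge, every vertex is incident with an edge:
    a path from it to another vertex starts with one. *)
Lemma cover_component_edges F x : component_edges F x != set0 ->
  F \subset edges adj -> cover (component_edges F x) = component F x.
Proof.
move=> /set0Pn [e eC] FE; apply/setP => y; apply/bigcupP/idP.
  by case=> e'; rewrite inE => /andP[_ /subsetP sub] /sub.
move=> yx.
suff [e' ye' e'F] : exists2 e' : {set T}, y \in e' & e' \in F.
  by exists e' => //; exact: edge_component ye' yx.
have := eC; rewrite inE => /andP[eF /subsetP esub].
have /edgesP[u [v [auv E]]] := subsetP FE _ eF.
have [z zy zx] : exists2 z, z != y & z \in component F y.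
  have [uy|] := eqVneq u y.
    exists v.
      by rewrite -uy; apply/eqP => vu; move: auv; rewrite vu adj_irr.
    by rewrite (component_eq yx); apply: esub; rewrite E !inE eqxx orbT.
  move=> uy; exists u => //.
  by rewrite (component_eq yx); apply: esub; rewrite E !inE eqxx.
move: zx; rewrite inE => /connectP[[|w p] /=]; first by move=> _ zy'; rewrite zy' eqxx in zy.
by case/andP=> yw _ _; exists [set y; w] => //; rewrite !inE eqxx.
Qed.

Hypothesis hexs_neq0 : set0 \notin hexs.
Hypothesis hexs_connected : forall t, t \in hexs ->
  forall x y, x \in cover t -> y \in cover t -> connect (edge_rel t) x y.

Lemma clar_cover_tiling F : clar_cover adj hexs F ->
  tiles_vertices setT [set component_edges F x | x : T].
Proof.
move=> /andP[FE /forallP FC].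
have ne0 x : component_edges F x != set0.
  apply/eqP => E; move: (FC x); rewrite E cards0 orbF => h.
  by move: hexs_neq0; rewrite h.
have cvr x : cover (component_edges F x) = component F x.
  exact: cover_component_edges.
split.
- by move=> t /imsetP[x _ ->]; exact: FC.
- move=> t t' z /imsetP[x _ ->] /imsetP[y _ ->]; rewrite !cvr => zx zy.
  rewrite !component_edgesE -(component_eq zx) -(component_eq zy) //.
- move=> x; rewrite inE; apply/esym/existsP; exists (component_edges F x).
  by rewrite imset_f // cvr component_refl.
Qed.

Lemma tile_connected t x y : tile t -> (t \subset edges adj) ->
  x \in cover t -> y \in cover t -> connect (edge_rel t) x y.
Proof.
case/orP => [th _|/cards1P[e ->]]; first exact: hexs_connected.
rewrite sub1set => /edgesP[u [v [uv E]]].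
have Euv : edge_rel [set e] u v by rewrite /edge_rel /= E inE.
have Evu : edge_rel [set e] v u by rewrite edge_rel_sym.
have -> : cover [set e] = [set u; v] by rewrite /cover big_set1.
by case/set2P=> -> /set2P[]->; rewrite ?connect0 //;
  [exact: (connect1 Euv)|exact: (connect1 Evu)].
Qed.

(** Tiles are connected and share no vertex, so no path of the
    union of the tiles leaves the tile where it starts. *)
Lemma tiling_component_edges TT t x :
  tiles_vertices setT TT -> (forall t, t \in TT -> t \subset edges adj) ->
  t \in TT -> x \in cover t -> component_edges (cover TT) x = t.
Proof.
move=> [tl dj cv] TE tT xt.
have inF t' e : t' \in TT -> e \in t' -> e \in cover TT by move=> ? ?; apply/bigcupP; exists t'.
have comp : component (cover TT) x = cover t.
  apply/setP => y; rewrite inE; apply/idP/idP => [/connectP[p]|yt]; last first.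
    apply: connect_sub (tile_connected (tl _ tT) (TE _ tT) xt yt).
    by move=> a b /= ab; apply: connect1; apply: inF ab.
  elim: p x xt => [|z p IH] x xt /=; first by move=> _ ->.
  case/andP => /bigcupP[t' t'T xz] pth lst; apply: (IH z) => //.
  have xt' : x \in cover t' by apply/bigcupP; exists [set x; z]; rewrite // !inE eqxx.
  rewrite (dj _ _ _ tT t'T xt xt'); apply/bigcupP; exists [set x; z]; rewrite // !inE eqxx orbT //.
rewrite component_edgesE comp; apply/setP => e; rewrite inE; apply/andP/idP.
  case=> /bigcupP[t' t'T et'] /subsetP esub.
  have /edgesP[u [v [_ E]]] := subsetP (TE _ t'T) _ et'.
  have ue : u \in e by rewrite E !inE eqxx.
  suff -> : t = t' by [].
  apply: (dj _ _ u) => //; first exact: esub.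
  by apply/bigcupP; exists e.
move=> et; split; first exact: inF et.
by apply/subsetP => u ue; apply/bigcupP; exists e.
Qed.

(** The components of a Clar cover form a tiling, and conversely the
    tiles of a tiling are the components of their union. *)
Lemma resonant_patternP P :
  reflect (exists TT, [/\ tiles_vertices setT TT,
      forall t, t \in TT -> t \subset edges adj & P = TT :&: hexs])
    (resonant_pattern adj hexs P).
Proof.
apply: (iffP existsP) => [[F /andP[FC /eqP->]]|[TT [tT tE ->]]].
  exists [set component_edges F x | x : T]; split => //.
    exact: clar_cover_tiling.
  move=> t /imsetP[x _ ->]; have /andP[/subsetP FE _] := FC.
  by apply/subsetP => e; rewrite inE => /andP[/FE].
have [tl dj cv] := tT.
have tile_of x : exists2 t, t \in TT & x \in cover t.
  by have := cv x; rewrite inE => /esym/existsP[t /andP[]]; exists t.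
exists (cover TT); apply/andP; split.
  apply/andP; split.
    by apply/subsetP => e /bigcupP[t /tE /subsetP]; apply.
  apply/forallP => x; have [t tTT xt] := tile_of x.
  by rewrite (tiling_component_edges tT tE tTT xt); apply: tl.
apply/eqP/setP => t; rewrite !inE; case th : (t \in hexs); rewrite ?andbF // !andbT.
apply/idP/imsetP => [tTT|[x _ ->]].
  have [e et] : exists e, e \in t.
    by apply/set0Pn/eqP => t0; move: hexs_neq0; rewrite -t0 th.
  have /edgesP[u [v [_ E]]] := subsetP (tE _ tTT) _ et.
  exists u => //; rewrite (tiling_component_edges tT tE tTT) //.
  by apply/bigcupP; exists e; rewrite // E !inE eqxx.
by have [t' t'T xt'] := tile_of x; rewrite (tiling_component_edges tT tE t'T xt').
Qed.

Lemma tiling_perfect_matching TT : tiles_vertices setT TT ->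
  (forall t, t \in TT -> t \subset edges adj) -> TT :&: hexs = set0 ->
  perfect_matching adj (cover TT).
Proof.
move=> [tl dj cv] tE noh; apply/andP; split.
  by apply/subsetP => e /bigcupP[t /tE /subsetP]; apply.
apply/forallP => x; have := cv x; rewrite inE => /esym/existsP[t /andP[tT xt]].
have : tile t by apply: tl.
have -> /= : tile t = (#|t| == 1%N).
  rewrite /tile; case th : (t \in hexs) => //.
  by have := in_set0 t; rewrite -noh inE tT th.
case/cards1P => e E; apply/cards1P; exists e; apply/setP => e'; rewrite !inE.
have xe : x \in e by move: xt; rewrite E /cover big_set1.
apply/andP/eqP => [[/bigcupP[t' t'T e't' xe']]|->]; last first.
  by split => //; apply/bigcupP; exists t; rewrite // E inE.
have xt' : x \in cover t' by apply/bigcupP; exists e'.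
by move: e't'; rewrite -(dj _ _ _ tT t'T xt xt') E inE => /eqP.
Qed.

Lemma tiles_vertices0 : tiles_vertices set0 set0.
Proof.
split=> [t|t t' x|x]; rewrite ?inE //.
by apply/esym/existsP => -[t]; rewrite inE.
Qed.

Lemma tiles_verticesU (A : {set T}) TT t : tiles_vertices A TT -> tile t ->
  [disjoint A & cover t] -> tiles_vertices (A :|: cover t) (t |: TT).
Proof.
move=> [tl dj cv] tt dis.
have out t' x : t' \in TT -> x \in cover t' -> x \in cover t -> t' = t.
  move=> t'T xt' xt; have xA : x \in A.
    by rewrite cv; apply/existsP; exists t'; rewrite t'T.
  by have := disjointFr dis xA; rewrite xt.
split.
- by move=> t'; rewrite !inE => /orP[/eqP->//|/tl].
- move=> t1 t2 x; rewrite !inE => /orP[/eqP->|t1T] /orP[/eqP->|t2T] x1 x2 //.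
  + by rewrite (out t2 x).
  + by rewrite (out t1 x).
  + exact: dj x2.
- move=> x; rewrite !inE cv; apply/orP/existsP.
    case=> [/existsP[t' /andP[t'T xt']]|xt]; [exists t'|exists t].
      by rewrite !inE t'T orbT.
    by rewrite !inE eqxx.
  case=> t'; rewrite !inE => /andP[/orP[/eqP-> ->|t'T xt']]; first by right.
  by left; apply/existsP; exists t'; rewrite t'T.
Qed.

End Tilings.

(** * Resonant patterns of a hexagonal chain *)

(** [unblocked kink chi i] is the state reached just before hexagon [i] when
    [chi] tells which hexagons are chosen: choosing a hexagon blocks the chain and
    a later kink that is not chosen frees it. A blocked chain has its next rung
    covered from the left in every Clar cover. *)
Fixpoint unblocked (kink chi : nat -> bool) (i : nat) : bool :=
  if i is j.+1 then if chi j then false else unblocked kink chi j || kink j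
  else true.

Lemma eq_unblocked kink chi chi' i : (forall j, (j < i)%N -> chi j = chi' j) ->
  unblocked kink chi i = unblocked kink chi' i.
Proof.
elim: i => //= i IH E; rewrite E // IH // => j ji; apply: E; exact: ltnW.
Qed.

(** The vertices of the hexagons before hexagon [i], together with its entry rung. *)
Definition left_part (T : finType) (p q a b : nat -> T) (i : nat) : {set T} :=
  iteri i (fun j A => A :|: [set a j; b j] :|: [set p j.+1; q j.+1])
    [set p 0; q 0].

(** The combinatorial content of a chain of [N] hexagons [hx 0], [hx 1], and so on.
    Hexagon [i] is entered through the rung [p i, q i] and left through the rung
    [p i.+1, q i.+1]; [a i] and [b i] are its two other vertices. In a straight hexagon
    these are the midpoints of the two paths that join the rungs; in a kink both lie on the
    longer path, hence are adjacent. *)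
Record hexagonal_chain (T : finType) (adj : rel T)
    (hexs : {set {set {set T}}}) (kink : nat -> bool) (N : nat)
    (hx : nat -> {set {set T}}) (p q a b : nat -> T) : Prop := HexagonalChain {
  chain_sym : symmetric adj;
  chain_irr : irreflexive adj;
  chain_edges : forall i, (i < N)%N -> hx i \subset edges adj;
  chain_connected : forall i, (i < N)%N -> forall x y,
    x \in cover (hx i) -> y \in cover (hx i) -> connect (edge_rel (hx i)) x y;
  chain_hexs : hexs = [set hx (val i) | i : 'I_N];
  chain_cover : forall i, (i < N)%N ->
    cover (hx i) =
      [set p i; q i] :|: [set a i; b i] :|: [set p i.+1; q i.+1];
  chain_all : left_part p q a b N = setT;
  chain_new : forall i, (i < N)%N ->
    all (fun x => x \notin left_part p q a b i)
      [:: a i; b i; p i.+1; q i.+1];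
  chain_uniq : forall i, (i < N)%N -> uniq [:: a i; b i; p i.+1; q i.+1];
  chain_rung : forall i, (i <= N)%N -> adj (p i) (q i);
  chain_kink : forall i, (i < N)%N -> kink i -> adj (a i) (b i);
  chain_top : forall i, (i < N)%N -> ~~ kink i ->
    forall x, adj (a i) x = (x \in [set p i; p i.+1]);
  chain_bot : forall i, (i < N)%N -> ~~ kink i ->
    forall x, adj (b i) x = (x \in [set q i; q i.+1]) }.

Section Chain.
Variables (T : finType) (adj : rel T) (hexs : {set {set {set T}}}).
Variables (kink : nat -> bool) (N : nat).
Variables (hx : nat -> {set {set T}}) (p q a b : nat -> T).
Hypothesis ch : hexagonal_chain adj hexs kink N hx p q a b.
Implicit Type chi : nat -> bool.

Local Notation left := (left_part p q a b).

Let adj_sym := chain_sym ch.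
Let adj_irr := chain_irr ch.

Lemma hexsP t : reflect (exists2 i, (i < N)%N & t = hx i) (t \in hexs).
Proof.
rewrite (chain_hexs ch); apply: (iffP imsetP) => [[i _ ->]|[i iN ->]].
  by exists i.
by exists (Ordinal iN).
Qed.

Lemma left_sub i j : (i <= j)%N -> left i \subset left j.
Proof.
elim: j => [|j IH]; first by rewrite leqn0 => /eqP->.
rewrite leq_eqVlt => /orP[/eqP->//|/IH /subset_trans]; apply.
by rewrite /left_part /= -setUA subsetUl.
Qed.

Lemma rung_left i : [set p i; q i] \subset left i.
Proof. by case: i => [|i]; rewrite /left_part //= subsetUr. Qed.

Lemma cover_left i : (i < N)%N -> cover (hx i) \subset left i.+1.
Proof.
move=> iN; rewrite (chain_cover ch iN) [left i.+1]/left_part /=.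
by do 2! apply: setSU; exact: rung_left.
Qed.

Lemma mid_notin i x : (i < N)%N -> x \in [:: a i; b i; p i.+1; q i.+1] ->
  x \notin left i.
Proof. by move=> /(chain_new ch)/allP; apply. Qed.

Lemma hx_mid i j x : (i < N)%N -> (j < N)%N -> x \in [:: a i; b i] ->
  x \in cover (hx j) -> i = j.
Proof.
move=> iN jN xi xj; have [ij|ji|//] := ltngtP i j; last first.
  have xl := subsetP (subset_trans (cover_left jN) (left_sub ji)) _ xj.
  have : x \notin left i.
    by apply: mid_notin => //; move: xi; rewrite !inE => /orP[]->; rewrite ?orbT.
  by rewrite xl.
have xl : x \in left j.
  apply: (subsetP (left_sub ij)); rewrite /left_part /= !inE.
  by move: xi; rewrite !inE => /orP[]->; rewrite ?orbT.
have : x \in [:: p j; q j].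
  move: xj; rewrite (chain_cover ch jN) !in_setU -orbA => /orP[|xj].
    by rewrite !inE.
  suff : x \notin left j by rewrite xl.
  by apply: mid_notin => //; move: xj; rewrite !inE -!orbA.
case: j ij jN xj xl => // j ij jN xj xl xr.
have [ji|ji] := eqVneq i j.
  have := chain_uniq ch iN; rewrite ji /=; move: xi xr; rewrite ji !inE.
  by move=> /orP[]/eqP-> /orP[]/eqP->; rewrite eqxx ?orbT ?andbF.
have {}ij : (i < j)%N by lia.
have : x \in left j.
  apply: (subsetP (left_sub ij)); rewrite /left_part /= !inE.
  by move: xi; rewrite !inE => /orP[]->; rewrite ?orbT.
suff /negPf-> : x \notin left j by [].
apply: mid_notin; first exact: ltnW.
by move: xr; rewrite !inE => /orP[]->; rewrite ?orbT.
Qed.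

Lemma hx_inj i j : (i < N)%N -> (j < N)%N -> hx i = hx j -> i = j.
Proof.
move=> iN jN E; apply: (@hx_mid i j (a i)) => //; rewrite ?inE ?eqxx //.
by rewrite -E (chain_cover ch iN) !inE eqxx !orbT.
Qed.

Lemma hexs_edges t : t \in hexs -> t \subset edges adj.
Proof. by move=> /hexsP[i iN ->]; exact: (chain_edges ch). Qed.

Lemma hexs_conn t : t \in hexs ->
  forall x y, x \in cover t -> y \in cover t -> connect (edge_rel t) x y.
Proof. by move=> /hexsP[i iN ->]; apply: (chain_connected ch). Qed.

Lemma hexs_mid t : t \in hexs -> exists2 i, (i < N)%N &
  {subset [:: a i; b i; p i.+1; q i.+1] <= cover t}.
Proof.
move=> /hexsP[i iN ->]; exists i => // x; rewrite (chain_cover ch iN) !inE.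
by case/or4P=> ->; rewrite /= ?orbT.
Qed.

Lemma hexs_nonempty : set0 \notin hexs.
Proof.
apply/negP => /hexs_mid[i iN] /(_ (a i)); rewrite /cover big_set0 !inE eqxx.
by move/(_ isT).
Qed.

Lemma hexs_nonedge x y : [set [set x; y]] \notin hexs.
Proof.
apply/negP => /hexs_mid[i iN]; rewrite /cover big_set1 => sub.
suff : (size [:: a i; b i; p i.+1; q i.+1] <= size [:: x; y])%N by [].
by apply: uniq_leq_size (chain_uniq ch iN) _ => z /sub; rewrite !inE.
Qed.

Definition tiled (A : {set T}) (P : {set {set {set T}}}) : Prop :=
  exists TT, [/\ tiles_vertices hexs A TT,
    forall t, t \in TT -> t \subset edges adj & TT :&: hexs = P].

Lemma tiled_edge A P x y : tiled A P -> adj x y -> x \notin A -> y \notin A ->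
  tiled (A :|: [set x; y]) P.
Proof.
move=> [TT [tA tE tP]] xy xA yA; exists ([set [set x; y]] |: TT); split.
- have E : cover [set [set x; y]] = [set x; y] by rewrite /cover big_set1.
  rewrite -[X in A :|: X]E.
  apply: tiles_verticesU => //; first by rewrite /tile cards1 orbT.
  rewrite E -setI_eq0; apply/eqP/setP => z; rewrite !inE.
  by apply/negP => /andP[zA /orP[]/eqP Ez]; move: zA; rewrite Ez ?(negPf xA) ?(negPf yA).
- move=> t; rewrite !inE => /orP[/eqP->|/tE//].
  by rewrite sub1set edge_adj.
- rewrite setIUl tP (_ : _ :&: _ = set0) ?set0U //.
  by apply/setP => t; rewrite !inE; apply/negP => /andP[/eqP->]; apply/negP/hexs_nonedge.
Qed.

Lemma tiled_hexagon A P i : tiled A P -> (i < N)%N ->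
  [disjoint A & cover (hx i)] -> tiled (A :|: cover (hx i)) (hx i |: P).
Proof.
move=> [TT [tA tE tP]] iN dis.
have hi : hx i \in hexs by apply/hexsP; exists i.
exists (hx i |: TT); split.
- by apply: tiles_verticesU => //; rewrite /tile hi.
- by move=> t; rewrite !inE => /orP[/eqP->|/tE//]; apply: hexs_edges.
- by rewrite setIUl tP (setIidPl _) // sub1set.
Qed.

Definition chosen (chi : nat -> bool) (i : nat) : {set {set {set T}}} :=
  [set hx (val j) | j : 'I_i & chi j].

Lemma chosenP (chi : nat -> bool) i t :
  reflect (exists j, [/\ (j < i)%N, chi j & t = hx j]) (t \in chosen chi i).
Proof.
apply: (iffP imsetP) => [[j]|[j [ji cj ->]]]; first by rewrite inE => ? ->; exists j.
by exists (Ordinal ji); rewrite ?inE.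
Qed.

Lemma chosenS chi i :
  chosen chi i.+1 = if chi i then hx i |: chosen chi i else chosen chi i.
Proof.
apply/setP => t; apply/chosenP/idP => [[j [ji cj ->]]|].
  move: ji; rewrite ltnS leq_eqVlt => /orP[/eqP <-|ji].
    by rewrite cj !inE eqxx.
  have cj' : hx j \in chosen chi i by apply/chosenP; exists j.
  by case: ifP => _; rewrite ?inE cj' ?orbT.
case: ifP => ci; rewrite ?inE.
  case/orP=> [/eqP->|/chosenP[j [ji cj ->]]]; first by exists i.
  by exists j; split => //; apply: ltnW.
by move=> /chosenP[j [ji cj ->]]; exists j; split => //; apply: ltnW.
Qed.

(** Extending a tiling hexagon by hexagon, with the entry rung covered in the
    first tiling and left uncovered in the second. A straight hexagon keeps each of the two
    states, a kink reaches both from the covered one (by the edge [a i, b i], with or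
    without the exit rung), and a chosen hexagon goes from uncovered to covered. *)
Lemma chain_tiled chi i : (i <= N)%N ->
  (forall j, (j < i)%N -> chi j -> unblocked kink chi j) ->
  tiled (left i) (chosen chi i) /\
  (unblocked kink chi i -> tiled (left i :\: [set p i; q i]) (chosen chi i)).
Proof.
have chosen0 : chosen chi 0 = set0.
  by apply/setP => t; rewrite inE; apply/negP => /chosenP[j []].
have tiled0 : tiled set0 set0.
  exists set0; split; first exact: tiles_vertices0.
    by move=> t; rewrite inE.
  by rewrite set0I.
elim: i => [|i IH] iN ok.
  rewrite chosen0; split=> [|_]; last by rewrite setDv.
  rewrite -[left 0]set0U; apply: tiled_edge; rewrite ?inE //.
  exact: (chain_rung ch).
have [D U] : tiled (left i) (chosen chi i) /\
    (unblocked kink chi i -> tiled (left i :\: [set p i; q i]) (chosen chi i)).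
  by apply: IH => [|j ji]; [exact: ltnW|apply: ok; exact: ltnW].
have /= /and5P[aL bL pL qL _] := chain_new ch iN.
have := chain_uniq ch iN; rewrite /= !inE !negb_or.
case/and4P=> [/and3P[ab ap aq] /andP[bp bq] pq _].
have leftS : left i.+1 = left i :|: [set a i; b i] :|: [set p i.+1; q i.+1] by [].
have leftSD : left i.+1 :\: [set p i.+1; q i.+1] = left i :|: [set a i; b i].
  rewrite leftS; apply/setP => z; rewrite !inE.
  case: (z =P p i.+1) => [->|_] /=.
    by rewrite (negPf pL) ![p _ == _]eq_sym (negPf ap) (negPf bp).
  case: (z =P q i.+1) => [->|_] /=.
    by rewrite (negPf qL) ![q _ == _]eq_sym (negPf aq) (negPf bq).
  by rewrite !orbF.
have rung : adj (p i.+1) (q i.+1) by apply: (chain_rung ch).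
have add_rung P : tiled (left i :|: [set a i; b i]) P -> tiled (left i.+1) P.
  move=> tA; rewrite leftS; apply: tiled_edge => //; rewrite !inE !negb_or.
    by rewrite pL ![p _ == _]eq_sym ap bp.
  by rewrite qL ![q _ == _]eq_sym aq bq.
have rungL : [set p i; q i] \subset left i by exact: rung_left.
rewrite chosenS -leftS leftSD; case: ifP => ci.
  split=> //; have fi : unblocked kink chi i by apply: ok.
  have -> : left i.+1 = (left i :\: [set p i; q i]) :|: cover (hx i).
    rewrite leftS (chain_cover ch iN) !setUA; congr (_ :|: _ :|: _).
    apply/setP => z; rewrite !inE; have := subsetP rungL z; rewrite !inE.
    by do 2!case: (_ == _) => //=; case: (z \in _) => // /(_ isT).
  apply: tiled_hexagon => //; first exact: U.
  rewrite (chain_cover ch iN) -setI_eq0; apply/eqP/setP => z; rewrite !inE.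
  case: (z =P p i) => //= _; case: (z =P q i) => //= _.
  apply/negP => /andP[zl]; rewrite -!orbA => /or4P[]/eqP E; move: zl; rewrite E.
  - by rewrite (negPf aL). - by rewrite (negPf bL).
  - by rewrite (negPf pL). - by rewrite (negPf qL).
have [ki|ki] := boolP (kink i).
  have DU : tiled (left i :|: [set a i; b i]) (chosen chi i).
    by apply: tiled_edge => //; apply: (chain_kink ch).
  by split=> //; apply: add_rung.
have top := chain_top ch iN ki; have bot := chain_bot ch iN ki.
split.
  have -> : left i.+1 = left i :|: [set a i; p i.+1] :|: [set b i; q i.+1].
    rewrite leftS; apply/setP => z; rewrite !inE.
    by case: (z == a i); case: (z == b i); case: (z == p i.+1); rewrite ?orbT ?orbF.
  apply: tiled_edge; first apply: tiled_edge => //.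
  - by rewrite top !inE eqxx orbT.
  - by rewrite bot !inE eqxx orbT.
  - by rewrite !inE !negb_or bL eq_sym ab bp.
  - by rewrite !inE !negb_or qL ![q _ == _]eq_sym aq pq.
rewrite orbF => /U {}U.
have -> : left i :|: [set a i; b i] =
    left i :\: [set p i; q i] :|: [set a i; p i] :|: [set b i; q i].
  apply/setP => z; rewrite !inE; have := subsetP rungL z; rewrite !inE.
  by case: (z == p i); case: (z == q i); case: (z == a i); case: (z == b i);
    case: (z \in left i) => // /(_ isT).
have npq : p i != q i.
  by apply/eqP => E; have := chain_rung ch (ltnW iN); rewrite E adj_irr.
have pl : p i \in left i by apply: (subsetP rungL); rewrite !inE eqxx.
have ql : q i \in left i by apply: (subsetP rungL); rewrite !inE eqxx orbT.
have neq x y : x \notin left i -> y \in left i -> (x == y) = false.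
  by move=> xl yl; apply/eqP => E; move: xl; rewrite E yl.
apply: tiled_edge; first apply: tiled_edge => //.
- by rewrite top !inE eqxx.
- by rewrite !inE (negPf aL) andbF.
- by rewrite !inE eqxx.
- by rewrite bot !inE eqxx.
- by rewrite !inE (negPf bL) andbF /= negb_or eq_sym ab (neq _ _ bL pl).
- by rewrite !inE eqxx orbT /= negb_or (eq_sym _ (a i)) (neq _ _ aL ql) eq_sym npq.
Qed.

(** A blocked rung is covered from the left: if the previous hexagon is chosen
    it is the tile that covers the rung; otherwise the previous hexagon is straight and its
    middle vertices, whose left neighbours are already covered, must be matched to the rung. *)
Lemma blocked_rung TT i : tiles_vertices hexs setT TT ->
  (forall t, t \in TT -> t \subset edges adj) -> (i < N)%N ->
  ~~ unblocked kink (fun j => hx j \in TT) i ->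
  forall t x, t \in TT -> x \in [set p i; q i] -> x \in cover t ->
    cover t \subset left i.
Proof.
move=> [tl dj cv] tE; elim: i => // i IH iN /=.
have {}iN : (i < N)%N by apply: ltnW.
case: ifP => [hi _ t x tT xr xt|hi].
  suff -> : t = hx i by apply: cover_left.
  apply: (dj _ _ x) => //; rewrite (chain_cover ch iN) in_setU xr orbT //.
rewrite negb_or => /andP[fi ki] t x tT xr xt.
have {}IH := IH iN fi.
(* [c] is a middle vertex, [r] its left and [r'] its right neighbour. *)
have aux c r r' : c \in [:: a i; b i] -> r \in [set p i; q i] ->
    (forall y, adj c y = (y \in [set r; r'])) -> r' \in cover t ->
    r' \in left i.+1 ->
    cover t \subset left i.+1.
  move=> cm rr cN r't r'l.
  have cl : c \notin left i.
    by apply: mid_notin => //; move: cm; rewrite !inE => /orP[]->; rewrite ?orbT.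
  have /existsP[tc /andP[tcT ctc]] : [exists t in TT, c \in cover t].
    by rewrite -cv inE.
  have /orP[/hexsP[j jN E]|/cards1P[e E]] : tile hexs tc by apply: tl.
    have ij : i = j by apply: (@hx_mid i j c) => //; rewrite -E.
    by move: hi; rewrite ij -E tcT.
  have ce : c \in e by move: ctc; rewrite E /cover big_set1.
  have /edgesP[u [v [uv Ee]]] : e \in edges adj by rewrite -sub1set -E tE.
  have [y cy {}Ee] : exists2 y, adj c y & e = [set c; y].
    move: ce; rewrite Ee => /set2P[->|->]; first by exists v.
    by exists u; rewrite 1?adj_sym // setUC.
  have cvr : cover tc = [set c; y] by rewrite E /cover big_set1.
  move: cy; rewrite cN => /set2P[yr|yr'].
    have := IH tc y tcT; rewrite cvr !inE eqxx orbT yr => /(_ _ isT) H.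
    have /subsetP/(_ c) : [set c; r] \subset left i by apply: H; move: rr; rewrite !inE.
    by rewrite !inE eqxx (negPf cl) => /(_ isT).
  have -> : t = tc by apply: (dj _ _ r') => //; rewrite cvr yr' !inE eqxx orbT.
  rewrite cvr yr' subUset !sub1set r'l andbT /left_part /= !inE.
  by move: cm; rewrite !inE => /orP[]->; rewrite ?orbT.
have pL := rung_left i.+1.
case/set2P: xr => E; rewrite E in xt.
  apply: (aux (a i) (p i) (p i.+1)) => //; first by rewrite inE eqxx.
  - by rewrite set21.
  - exact: (chain_top ch).
  - by apply: (subsetP pL); rewrite set21.
apply: (aux (b i) (q i) (q i.+1)) => //; first by rewrite !inE eqxx orbT.
- by rewrite set22.
- exact: (chain_bot ch).
- by apply: (subsetP pL); rewrite set22.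
Qed.

Lemma chain_resonantP P :
  reflect (exists chi, (forall j, (j < N)%N -> chi j -> unblocked kink chi j) /\
                       P = chosen chi N)
    (resonant_pattern adj hexs P).
Proof.
apply: (iffP (resonant_patternP adj_irr hexs_nonempty hexs_conn P)).
  case=> TT [tT tE ->]; exists (fun j => hx j \in TT); split.
    move=> j jN hj; apply: contraT => fj.
    have pj : p j \in cover (hx j) by rewrite (chain_cover ch jN) !inE eqxx.
    have := blocked_rung tT tE jN fj hj _ pj.
    rewrite !inE eqxx => /(_ isT) /subsetP/(_ (a j)).
    rewrite (chain_cover ch jN) !inE eqxx !orbT => /(_ isT).
    by rewrite (negPf (mid_notin jN _)) // inE eqxx.
  apply/setP => t; rewrite inE; apply/andP/chosenP.
    by case=> tTT /hexsP[j jN E]; exists j; rewrite -E.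
  by case=> j [jN hj ->]; split => //; apply/hexsP; exists j.
case=> chi [ok ->]; have [[TT]] := chain_tiled (leqnn N) ok.
by rewrite (chain_all ch) => -[tT tE tP] _; exists TT.
Qed.

Lemma chain_perfect_matching : exists M, perfect_matching adj M.
Proof.
have [] := @chain_tiled (fun=> false) N (leqnn N) => // -[TT].
rewrite (chain_all ch) => -[tT tE tP] _; exists (cover TT).
apply: (tiling_perfect_matching tT tE); rewrite tP; apply/setP => t.
by rewrite inE; apply/negP => /chosenP[j []].
Qed.

End Chain.

Import GRing.Theory.
Local Open Scope ring_scope.

(** * Transfer recursion for the sextet polynomial *)

Section TransferSum.
Variables (R : comNzRingType) (x : R) (kink : nat -> bool) (N : nat).
Implicit Types (I J : {set 'I_N}) (i j : nat).

(** The total weights [x ^ (number of chosen hexagons)] of the ways to choose only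
    unblocked hexagons among the first [i], separated by whether they leave the chain unblocked
    or blocked. *)
Fixpoint weights i : R * R :=
  if i is j.+1 then
    let: (f, k) := weights j in
    if kink j then (f + k, x * f) else (f, k + x * f)
  else (1, 0).

Lemma weightsS i : weights i.+1 =
  if kink i then ((weights i).1 + (weights i).2, x * (weights i).1)
  else ((weights i).1, (weights i).2 + x * (weights i).1).
Proof. by rewrite /=; case: (weights i). Qed.

(** Membership in [I] as a predicate on all natural numbers, the form
    that [unblocked] expects. *)
Definition indic I j : bool := oapp (mem I) false (insub j).

Definition admissible I : bool := [forall k in I, unblocked kink (indic I) (val k)].

Definition below i : {set 'I_N} := [set k : 'I_N | (val k < i)%N].

Definition transfer_sum i (s : bool) : R :=
  \sum_(I : {set 'I_N} | [&& I \subset below i, admissible I & unblocked kink (indic I) i == s])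
     x ^+ #|I|.

Lemma indicE I (k : 'I_N) : indic I (val k) = (k \in I).
Proof. by rewrite /indic valK. Qed.

Lemma subset_belowS I (k : 'I_N) :
  (I \subset below k.+1) && (k \notin I) = (I \subset below k).
Proof.
apply/andP/subsetP => [[/subsetP sub kI] j jI|sub].
  have := sub j jI; rewrite !inE ltnS leq_eqVlt => /orP[/eqP/val_inj E|//].
  by move: kI; rewrite -E jI.
split; last by apply/negP => /sub; rewrite inE ltnn.
by apply/subsetP => j /sub; rewrite !inE => /ltnW.
Qed.

Lemma unblocked_indicU J (k : 'I_N) i : (i <= k)%N ->
  unblocked kink (indic (k |: J)) i = unblocked kink (indic J) i.
Proof.
move=> ik; apply: eq_unblocked => j ji.
have jN : (j < N)%N by have := ltn_ord k; lia.
rewrite -[j]/(val (Ordinal jN)) !indicE !inE orbC; case: (_ \in J) => //=.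
by apply/eqP => /(congr1 val) /= E; lia.
Qed.

Lemma admissibleU J (k : 'I_N) : J \subset below k ->
  admissible (k |: J) = admissible J && unblocked kink (indic J) k.
Proof.
move=> /subsetP sub; apply/forall_inP/andP => [ok|[/forall_inP ok okk] j].
  split; last by rewrite -(unblocked_indicU J (leqnn k)) ok // !inE eqxx.
  apply/forall_inP => j jJ; have := sub j jJ; rewrite inE => jk.
  by rewrite -(unblocked_indicU J (ltnW jk)) ok // !inE jJ orbT.
rewrite !inE => /orP[/eqP->|jJ]; first by rewrite unblocked_indicU.
have := sub j jJ; rewrite inE => jk; rewrite unblocked_indicU ?ok //; exact: ltnW.
Qed.

(** Split according to whether hexagon [k] is chosen. If so, the chain has
    to be unblocked before it and is blocked after it. *)
Lemma transfer_sumS (k : 'I_N) s :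
  transfer_sum k.+1 s =
    (if s then (transfer_sum k true + (if kink k then transfer_sum k false else 0))
     else (if kink k then 0 else transfer_sum k false) + x * transfer_sum k true).
Proof.
rewrite /transfer_sum (bigID (fun I => k \in I)) /= addrC.
have -> : \sum_(I : {set 'I_N} | [&& I \subset below k.+1, admissible I
        & unblocked kink (indic I) k.+1 == s] && (k \notin I)) x ^+ #|I| =
    \sum_(I : {set 'I_N} | [&& I \subset below k, admissible I &
        (unblocked kink (indic I) k || kink k) == s]) x ^+ #|I|.
  apply: eq_bigl => I; rewrite -(subset_belowS I k) -!andbA.
  case: (I \subset _) => //=; case kI: (k \in I); rewrite ?andbF //=.
  by rewrite indicE kI !andbT.
have -> : \sum_(I : {set 'I_N} | [&& I \subset below k.+1, admissible I
        & unblocked kink (indic I) k.+1 == s] && (k \in I)) x ^+ #|I| =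
    if s then 0 else x * transfer_sum k true.
  (* Choices with [k] correspond to choices without it, with one factor [x] less. *)
  rewrite (reindex_onto (fun J => k |: J) (fun I => I :\ k)) /=; last first.
    by move=> I /andP[_ kI]; rewrite setD1K.
  have E J : [&& [&& k |: J \subset below k.+1, admissible (k |: J) &
       (if indic (k |: J) k then false
        else unblocked kink (indic (k |: J)) k || kink k) == s], k \in k |: J
       & (k |: J) :\ k == J] =
      ~~ s && [&& J \subset below k, admissible J & unblocked kink (indic J) k == true].
    rewrite (indicE (k |: J) k) !inE eqxx /= eq_sym eqbF_neg.
    have -> : ((k |: J) :\ k == J) = (k \notin J).
      apply/eqP/idP => [<-|kJ]; first by rewrite !inE eqxx.
      by apply/setP => j; rewrite !inE; case: eqP => // ->; rewrite (negPf kJ).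
    rewrite eqb_id subUset sub1set inE ltnSn /= -(subset_belowS J k).
    case: (boolP (J \subset below k.+1)) => //= sub; rewrite ?andbF //.
    case: (boolP (k \in J)) => kJ /=; rewrite ?andbF ?andbT //.
    have := subset_belowS J k; rewrite sub kJ => /esym sk.
    by rewrite admissibleU // andbC.
  rewrite (eq_bigl _ _ (fun J => etrans (esym (andbA _ _ _)) (E J))).
  case: s {E} => /=; first by rewrite big_pred0.
  rewrite big_distrr /=; apply: eq_bigr => J /and3P[sub _ _].
  rewrite -exprS cardsU1; suff -> : k \notin J by [].
  by apply/negP => /(subsetP sub); rewrite inE ltnn.
case: s; rewrite /= ?addr0.
  case: ifP => ki; last first.
    by rewrite addr0; apply: eq_bigl => I; rewrite orbF.
  rewrite (bigID (fun I => unblocked kink (indic I) k)) /=; congr (_ + _).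
    by apply: eq_bigl => I; rewrite orbT andbT eqb_id andbA.
  by apply: eq_bigl => I; rewrite orbT andbT eqbF_neg andbA.
congr (_ + _); case: ifP => ki; last by apply: eq_bigl => I; rewrite orbF.
by rewrite big_pred0 // => I; rewrite orbT !andbF.
Qed.

Lemma transfer_sumE i : (i <= N)%N ->
  weights i = (transfer_sum i true, transfer_sum i false).
Proof.
elim: i => [_|i IH iN].
  have sub0 I : (I \subset below 0) = (I == set0).
    apply/subsetP/eqP => [sub|-> j]; last by rewrite inE.
    by apply/setP => j; rewrite inE; apply/negP => /sub; rewrite inE.
  have admissible0 : admissible set0 by apply/forall_inP => j; rewrite inE.
  congr (_, _).
    rewrite /transfer_sum (big_pred1 set0) ?cards0 // => I; rewrite sub0.
    by have [->|/negPf I0] := eqVneq I set0; rewrite /= ?admissible0 ?I0 ?eqxx.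
  by rewrite /transfer_sum big_pred0 // => I; rewrite /= !andbF.
have := transfer_sumS (Ordinal iN) => S; rewrite !(S true, S false) /=.
by rewrite (IH (ltnW iN)) /=; case: ifP => _; rewrite ?addr0 ?add0r.
Qed.

Lemma sum_admissible :
  \sum_(I : {set 'I_N} | admissible I) x ^+ #|I| = (weights N).1 + (weights N).2.
Proof.
rewrite transfer_sumE //= /transfer_sum.
rewrite (bigID (fun I => unblocked kink (indic I) N)) /=.
have sub I : I \subset below N by apply/subsetP => j; rewrite inE ltn_ord.
by congr (_ + _); apply: eq_bigl => I; rewrite sub /= ?eqb_id ?eqbF_neg.
Qed.

End TransferSum.

Section ChainSextet.
Variables (T : finType) (adj : rel T) (hexs : {set {set {set T}}}).
Variables (kink : nat -> bool) (N : nat).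
Variables (hx : nat -> {set {set T}}) (p q a b : nat -> T).
Hypothesis ch : hexagonal_chain adj hexs kink N hx p q a b.

(** A chosen set can be read off from its pattern, as distinct positions
    carry distinct hexagons; so summing over patterns is summing over choices. *)
Lemma sum_resonant (R : comNzRingType) (x : R) :
  \sum_(P | resonant_pattern adj hexs P) x ^+ #|P| =
  (weights x kink N).1 + (weights x kink N).2.
Proof.
rewrite -(sum_admissible x kink N).
pose h (I : {set 'I_N}) : {set {set {set T}}} := [set hx (val i) | i in I].
have hx_ord_inj : injective (fun i : 'I_N => hx (val i)).
  by move=> i j E; apply: val_inj; apply: (hx_inj ch) E; apply: ltn_ord.
have h_inj : injective h by apply: imset_inj.
have hE I : h I = chosen hx (indic I) N.
  apply/setP => t; apply/imsetP/chosenP => [[i iI ->]|[j [jN cj ->]]].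
    by exists i; rewrite indicE.
  by exists (Ordinal jN); rewrite // -indicE.
have chosen_eq (chi chi' : nat -> bool) : chosen hx chi N = chosen hx chi' N ->
    forall j, (j < N)%N -> chi j -> chi' j.
  move=> /setP E j jN cj; have /chosenP[j' [jN' cj' E']] : hx j \in chosen hx chi' N.
    by rewrite -E; apply/chosenP; exists j.
  by rewrite (hx_inj ch jN jN' E').
(* A pattern is the image of the set of positions of its hexagons. *)
rewrite (reindex_onto h (fun P => [set i : 'I_N | hx (val i) \in P])) /=.
  apply: eq_big => [I|I _]; last by rewrite card_imset.
  have -> : [set i | hx (val i) \in h I] == I.
    by apply/eqP/setP => i; rewrite inE mem_imset.
  rewrite andbT; apply/(chain_resonantP ch)/forall_inP => [[chi [ok E]] k kI|ok].
    have {}E j : (j < N)%N -> indic I j = chi j.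
      by move=> jN; apply/idP/idP; apply: (chosen_eq) => //; rewrite -hE.
    rewrite (@eq_unblocked _ _ chi) => [|j jk].
      by apply: ok; [exact: ltn_ord|rewrite -E ?indicE ?ltn_ord].
    by apply: E; apply: ltn_trans jk (ltn_ord k).
  exists (indic I); split => // j jN; rewrite -[j]/(val (Ordinal jN)) indicE.
  exact: ok.
move=> P /(chain_resonantP ch)[chi [_ ->]]; apply/setP => t.
apply/imsetP/chosenP => [[i]|[j [jN cj ->]]].
  by rewrite inE => /chosenP[j [jN cj E]] ->; exists j.
exists (Ordinal jN) => //; rewrite inE; apply/chosenP; exists j => //.
Qed.

Lemma sum_resonant_count (R : comNzRingType) (x : R) :
  \sum_(k < (clar_number_of adj hexs).+1)
     (resonant_count adj hexs k)%:R * x ^+ k =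
  \sum_(P | resonant_pattern adj hexs P) x ^+ #|P|.
Proof.
rewrite (partition_big (fun P : {set {set {set T}}} => inord #|P| : 'I_(clar_number_of adj hexs).+1)
  predT) //=; apply: eq_bigr => k _.
have E P : resonant_pattern adj hexs P -> (inord #|P| == k) = (#|P| == k).
  move=> rP; rewrite -val_eqE /= inordK // ltnS.
  exact: (bigmax_sup P).
rewrite (eq_bigl (fun P => P \in [set P | resonant_pattern adj hexs P & #|P| == k])).
  rewrite (eq_bigr (fun=> x ^+ k)); last by move=> P; rewrite inE => /andP[_ /eqP->].
  by rewrite sumr_const mulr_natl.
by move=> P; rewrite inE; case rP: (resonant_pattern _ _ _) => //=; rewrite E.
Qed.

End ChainSextet.

Import Order.TTheory Num.Theory.

(** * Hexagonal chains in the triangular lattice *)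

(** The six unit vectors of the triangular lattice in counterclockwise order, in
    coordinates along two unit vectors at an angle of 60 degrees. *)
Definition hexdir (k : nat) : int * int :=
  nth (0, 0) [:: (1, 0); (0, 1); (-1, 1); (-1, 0); (0, -1); (1, -1)] k.

Section Lattice.
Variable dir : nat -> bool.

(** [dir i] tells whether the step into hexagon [i] goes up or down. Both steps
    go to the right. *)
Fixpoint cell_center (i : nat) : int * int :=
  if i is j.+1 then cell_center j + (if dir i then (1, 1) else (2, -1)) else 0.

Definition corner (i k : nat) : int * int := cell_center i + hexdir k.

Lemma corner_inj i k l : (k < 6)%N -> (l < 6)%N -> corner i k = corner i l -> k = l.
Proof.
move=> k6 l6 /addrI; move: k l k6 l6.
by do 6![case=> [|] //]; do 7?[case=> //].
Qed.

(** The horizontal coordinate [2 u + v] grows by 3 with every hexagon, whichever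
    way the chain turns. *)
Lemma cell_center_level i : 2 * (cell_center i).1 + (cell_center i).2 = 3 * i%:Z.
Proof. by elim: i => //= i IH; case: (dir i.+1) => /=; lia. Qed.

(** The corners of a hexagon lie at horizontal distance at most 2 from its
    center and centers are 3 apart, so only neighbouring hexagons share corners. *)
Lemma corner_near i j k l : (k < 6)%N -> (l < 6)%N -> corner i k = corner j l ->
  (i <= j.+1)%N /\ (j <= i.+1)%N.
Proof.
move=> k6 l6 [/= E1 E2]; have := cell_center_level i; have := cell_center_level j.
have bound m : (m < 6)%N -> -2 <= 2 * (hexdir m).1 + (hexdir m).2 <= 2.
  by do 6![case: m => [|m] //].
by have := bound k k6; have := bound l l6; lia.
Qed.

Lemma cell_center_mono i j : (i <= j)%N ->
  (cell_center i).1 <= (cell_center j).1 /\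
  (cell_center i).1 + (cell_center i).2 <= (cell_center j).1 + (cell_center j).2.
Proof.
elim: j => [|j IH]; first by rewrite leqn0 => /eqP->.
rewrite leq_eqVlt => /orP[/eqP->//|/IH] /=; case: (dir j.+1) => /=; lia.
Qed.

(** Centers are the lattice points of one class modulo 3 and corners belong
    to the two other classes. This is what separates cells from edges below. *)
Lemma cell_center_class i : (3 %| (cell_center i).1 - (cell_center i).2)%Z.
Proof. elim: i => //= i; case: (dir i.+1) => /=; lia. Qed.

Lemma corner_class i k : (k < 6)%N -> ~~ (3 %| (corner i k).1 - (corner i k).2)%Z.
Proof.
have := cell_center_class i; rewrite /corner /=; case: k => [|[|[|[|[|[|k]]]]]] //=; lia.
Qed.

Definition rung_top i := cell_center i + hexdir (if dir i then 3 else 2).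
Definition rung_bot i := cell_center i + hexdir (if dir i then 4 else 3).
(** The index of the corner that plays the role of [a] in [hexagonal_chain]. *)
Definition mid_a i := if dir i then 2%N else if dir i.+1 then 4%N else 1%N.
Definition mid_b i := if dir i.+1 then 5%N else if dir i then 1%N else 4%N.

Lemma rung_topS i : rung_top i.+1 = corner i (if dir i.+1 then 1 else 0).
Proof. by rewrite /rung_top /corner /= -addrA; case: (dir i.+1). Qed.

Lemma rung_botS i : rung_bot i.+1 = corner i (if dir i.+1 then 0 else 5).
Proof. by rewrite /rung_bot /corner /= -addrA; case: (dir i.+1). Qed.

Definition turn i := dir i != dir i.+1.

(** The linear form that is constant on the entry rung of hexagon [i]. It increases
    along the chain, so it separates the earlier hexagons from hexagon [i]. *)
Definition entry_form i (z : int * int) : int := if dir i then z.1 + z.2 else z.1.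

Variable n : nat.

Definition corners : seq (int * int) :=
  [seq corner i k | i <- iota 0 n.+1, k <- iota 0 6].

Definition cell_vertex : finType := seq_sub corners.

Lemma cornersP z :
  reflect (exists i k, [/\ (i < n.+1)%N, (k < 6)%N & z = corner i k]) (z \in corners).
Proof.
apply: (iffP allpairsP) => [[[i k] []]|[i [k [iN k6 ->]]]].
  by rewrite !mem_iota => ? ? ->; exists i, k.
by exists (i, k); split => //; rewrite mem_iota.
Qed.

Lemma corner00 : corner 0 0 \in corners.
Proof. by apply/cornersP; exists 0%N, 0%N. Qed.

Definition vtx (z : int * int) : cell_vertex := insubd (SeqSub corner00) z.

Lemma vtxK z : z \in corners -> val (vtx z) = z.
Proof. by move=> zc; rewrite insubdK. Qed.

Definition cell_corner (i : nat) (k : 'I_6) : cell_vertex := vtx (corner i k).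

Lemma val_cell_corner i k : (i < n.+1)%N -> val (cell_corner i k) = corner i k.
Proof. by move=> iN; apply: vtxK; apply/cornersP; exists i, (val k); rewrite ltn_ord. Qed.

Lemma cell_corner_inj i : (i < n.+1)%N -> injective (cell_corner i).
Proof.
move=> iN k l /(congr1 val); rewrite !val_cell_corner // => /corner_inj E.
by apply: val_inj; apply: E.
Qed.

Lemma cell_vertexP (x : cell_vertex) :
  exists i k, (i < n.+1)%N /\ x = cell_corner i k.
Proof.
have /cornersP[i [k [iN k6 E]]] := valP x; exists i, (Ordinal k6); split=> //.
by apply: val_inj; rewrite val_cell_corner.
Qed.

Definition cell_edges (i : nat) : {set {set cell_vertex}} :=
  [set [set cell_corner i k; cell_corner i (ordS k)] | k : 'I_6].

Definition cell_adj : rel cell_vertex :=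
  [rel x y | [exists i : 'I_n.+1, [set x; y] \in cell_edges i] && (x != y)].

Lemma ordS_neq (k : 'I_6) : ordS k != k.
Proof. by apply/eqP => /(congr1 val) /=; have := ltn_ord k; lia. Qed.

Lemma cell_adjP x y :
  reflect (exists i k, (i < n.+1)%N /\
     (x = cell_corner i k /\ y = cell_corner i (ordS k) \/
      y = cell_corner i k /\ x = cell_corner i (ordS k)))
    (cell_adj x y).
Proof.
apply: (iffP andP) => [[/existsP[i /imsetP[k _ E]] xy]|[i [k [iN E]]]].
  exists i, k; split; first exact: ltn_ord.
  have /set2P[ex|ex] : x \in [set cell_corner i k; cell_corner i (ordS k)].
    by rewrite -E set21.
  - have /set2P[ey|ey] : y \in [set cell_corner i k; cell_corner i (ordS k)].
      by rewrite -E set22.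
      by move: xy; rewrite ex ey eqxx.
    by left.
  - have /set2P[ey|ey] : y \in [set cell_corner i k; cell_corner i (ordS k)].
      by rewrite -E set22.
      by right.
    by move: xy; rewrite ex ey eqxx.
have ne : cell_corner i (ordS k) != cell_corner i k.
  by rewrite (inj_eq (cell_corner_inj iN)) ordS_neq.
split.
  apply/existsP; exists (Ordinal iN); apply/imsetP; exists k => //.
  by case: E => -[-> ->] //; rewrite setUC.
by case: E => -[-> ->] //; rewrite eq_sym.
Qed.

Lemma cell_adj_sym : symmetric cell_adj.
Proof. by move=> x y; rewrite /cell_adj /= setUC eq_sym. Qed.

Lemma cell_adj_irr : irreflexive cell_adj.
Proof. by move=> x; rewrite /cell_adj /= eqxx andbF. Qed.

Lemma cell_adj_ordS i k : (i < n.+1)%N ->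
  cell_adj (cell_corner i k) (cell_corner i (ordS k)).
Proof. by move=> iN; apply/cell_adjP; exists i, k; split=> //; left. Qed.

Lemma cover_cell_edges i x :
  reflect (exists k, x = cell_corner i k) (x \in cover (cell_edges i)).
Proof.
apply: (iffP bigcupP) => [[e /imsetP[k _ ->]]|[k ->]].
  by case/set2P => ->; [exists k|exists (ordS k)].
exists [set cell_corner i k; cell_corner i (ordS k)]; last by rewrite set21.
by apply/imsetP; exists k.
Qed.

Local Notation p i := (vtx (rung_top i)).
Local Notation q i := (vtx (rung_bot i)).
Local Notation a i := (vtx (corner i (mid_a i))).
Local Notation b i := (vtx (corner i (mid_b i))).

(** The corner indices of hexagon [i] in the order: entry rung, two middle vertices, exit
    rung. It is a permutation of the six indices for each of the four combinations of
    entering and leaving directions. *)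
Definition role (i : nat) : seq nat :=
  [:: if dir i then 3 else 2; if dir i then 4 else 3; mid_a i; mid_b i;
      if dir i.+1 then 1 else 0; if dir i.+1 then 0 else 5]%N.

Lemma role_perm i : perm_eq (role i) (iota 0 6).
Proof. by rewrite /role /mid_a /mid_b; case: (dir i); case: (dir i.+1). Qed.

Lemma role_vtx i : [seq vtx (corner i k) | k <- role i] =
  [:: p i; q i; a i; b i; p i.+1; q i.+1].
Proof. by rewrite /= -rung_topS -rung_botS. Qed.

Lemma cover_cell_roles i : (i < n.+1)%N ->
  cover (cell_edges i) = [set p i; q i] :|: [set a i; b i] :|: [set p i.+1; q i.+1].
Proof.
move=> iN; apply/setP => x.
transitivity (x \in [seq vtx (corner i k) | k <- role i]).
  apply/cover_cell_edges/mapP => [[k ->]|[k]].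
    by exists (val k); rewrite ?(perm_mem (role_perm i)) ?mem_iota //=.
  by rewrite (perm_mem (role_perm i)) mem_iota => /= k6 ->; exists (Ordinal k6).
by rewrite role_vtx !inE -!orbA.
Qed.

Lemma role_uniq i : (i < n.+1)%N -> uniq [:: p i; q i; a i; b i; p i.+1; q i.+1].
Proof.
move=> iN; rewrite -role_vtx map_inj_in_uniq; first by rewrite (perm_uniq (role_perm i)) iota_uniq.
move=> k l; rewrite !(perm_mem (role_perm i)) !mem_iota /= => k6 l6 /(congr1 val).
by rewrite !vtxK; [exact: corner_inj|apply/cornersP; exists i, l|apply/cornersP; exists i, k].
Qed.

Lemma mem_left_part i x : x \in left_part (fun i => p i) (fun i => q i)
    (fun i => a i) (fun i => b i) i ->
  x \in [set p i; q i] \/ exists j k, [/\ (j < i)%N, (k < 6)%N & x = vtx (corner j k)].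
Proof.
elim: i => [|i IH]; first by left.
have lt_role k : k \in role i -> (k < 6)%N.
  by rewrite (perm_mem (role_perm i)) mem_iota.
rewrite /left_part /= -/(left_part _ _ _ _ _) -setUA in_setU => /orP[/IH[xr|[j [k [ji k6 ->]]]]|xn].
- right; suff : x \in [seq vtx (corner i k) | k <- role i].
    by case/mapP => k /lt_role k6 ->; exists i, k.
  by rewrite role_vtx; move: xr; rewrite !inE => /orP[]->; rewrite ?orbT.
- by right; exists j, k; rewrite ltnS (ltnW ji).
- right; suff : x \in [seq vtx (corner i k) | k <- role i].
    by case/mapP => k /lt_role k6 ->; exists i, k.
  by rewrite role_vtx; move: xn; rewrite !inE -!orbA => /or4P[]->; rewrite ?orbT.
Qed.

Lemma rung_top_corners i : (i <= n.+1)%N -> rung_top i \in corners.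
Proof.
case: i => [_|i iN]; apply/cornersP.
  by exists 0%N, (if dir 0 then 3 else 2)%N; split=> //; case: ifP.
by rewrite rung_topS; exists i, (if dir i.+1 then 1 else 0)%N; split=> //; case: ifP.
Qed.

Lemma rung_bot_corners i : (i <= n.+1)%N -> rung_bot i \in corners.
Proof.
case: i => [_|i iN]; apply/cornersP.
  by exists 0%N, (if dir 0 then 4 else 3)%N; split=> //; case: ifP.
by rewrite rung_botS; exists i, (if dir i.+1 then 0 else 5)%N; split=> //; case: ifP.
Qed.

Lemma corner_corners i k : (i < n.+1)%N -> (k < 6)%N -> corner i k \in corners.
Proof. by move=> iN k6; apply/cornersP; exists i, k. Qed.

(** The corners of earlier hexagons and the entry rung lie on the near side of
    the line through the center of hexagon [i] parallel to its entry rung. *)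
Lemma left_part_level i x : (i <= n.+1)%N -> x \in left_part (fun i => p i)
    (fun i => q i) (fun i => a i) (fun i => b i) i ->
  entry_form i (val x) < entry_form i (cell_center i).
Proof.
move=> iN /mem_left_part[/set2P[]->|[j [k [ji k6 ->]]]].
- rewrite vtxK ?rung_top_corners // /rung_top /entry_form /=.
  by case: (dir i) => /=; lia.
- rewrite vtxK ?rung_bot_corners // /rung_bot /entry_form /=.
  by case: (dir i) => /=; lia.
rewrite vtxK; last by apply: corner_corners => //; lia.
have bound : (hexdir k).1 <= 1 /\ (hexdir k).1 + (hexdir k).2 <= 1.
  by move: k6; do 6![case: k => [|k] //].
case: i ji iN => // i ji iN; have [m1 m2] := cell_center_mono (ji : (j <= i)%N).
by rewrite /entry_form /corner /=; case: (dir i.+1) => /=; lia.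
Qed.

Lemma role_new i k : (i < n.+1)%N -> k \in drop 2 (role i) ->
  vtx (corner i k) \notin left_part (fun i => p i) (fun i => q i)
    (fun i => a i) (fun i => b i) i.
Proof.
move=> iN kr; have k6 : (k < 6)%N.
  have : k \in role i by exact: mem_drop kr.
  by rewrite (perm_mem (role_perm i)) mem_iota.
apply/negP => /(left_part_level (ltnW iN)); rewrite vtxK ?corner_corners //.
rewrite /entry_form /corner; move: kr; rewrite /= /mid_a /mid_b !inE.
by case: (dir i); case: (dir i.+1) => /or4P[]/eqP-> /=; lia.
Qed.

(** In a straight hexagon no middle vertex lies on a rung, so no other
    hexagon contains it. *)
Lemma mid_only i j k l : ~~ turn i -> k \in [:: mid_a i; mid_b i] -> (l < 6)%N ->
  corner i k = corner j l -> i = j.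
Proof.
move=> ti kr l6 E.
have k6 : (k < 6)%N.
  suff : k \in role i by rewrite (perm_mem (role_perm i)) mem_iota.
  by move: kr; rewrite !inE => /orP[]->; rewrite ?orbT.
have [ij ji] := corner_near k6 l6 E.
have [//|[]] : i = j \/ i = j.+1 \/ j = i.+1 by lia.
  move=> Eij; move: E kr ti; rewrite Eij /turn /corner /mid_a /mid_b /= => -[] /= E1 E2.
  rewrite !inE; case: (dir j.+1) E1 E2; case: (dir j.+2) => E1 E2 // /orP[]/eqP kE _; move: E1 E2;
  by rewrite kE; move: l6; case: l => [|[|[|[|[|[|l]]]]]] //=; lia.
move=> Eij; move: E kr ti; rewrite Eij /turn /corner /mid_a /mid_b /= => -[] /= E1 E2.
rewrite !inE; case: (dir i.+1) E1 E2; case: (dir i) => E1 E2 // /orP[]/eqP kE _; move: E1 E2;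
by rewrite kE; move: l6; case: l => [|[|[|[|[|[|l]]]]]] //=; lia.
Qed.

Lemma mid_adj i (k : 'I_6) x : (i < n.+1)%N -> ~~ turn i ->
  val k \in [:: mid_a i; mid_b i] ->
  cell_adj (cell_corner i k) x =
    (x \in [set cell_corner i (ordS k); cell_corner i (ord_pred k)]).
Proof.
move=> iN ti kr; apply/cell_adjP/set2P => [[j [l [jN E]]]|].
  have ij m : cell_corner i k = cell_corner j m -> i = j /\ k = m.
    move=> E'; have ij : i = j.
      move/(congr1 val): E'; rewrite !val_cell_corner //; apply: mid_only => //.
    by split=> //; move: E'; rewrite -ij => /(cell_corner_inj iN).
  case: E => -[E1 E2]; first by have [ij' kl] := ij _ E1; left; rewrite E2 ij' kl.
  by have [ij' kl] := ij _ E2; right; rewrite E1 ij' kl ordSK.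
case=> ->; first by exists i, k; split => //; left.
by exists i, (ord_pred k); split => //; right; rewrite ord_predK.
Qed.

Lemma cell_corner_connect (e : rel cell_vertex) i k : symmetric e ->
  (forall k, e (cell_corner i k) (cell_corner i (ordS k))) ->
  connect e (cell_corner i ord0) (cell_corner i k).
Proof.
move=> es step.
have Ek m (h : (m < 6)%N) (h' : (m.+1 < 6)%N) : Ordinal h' = ordS (Ordinal h).
  by apply: val_inj => /=; rewrite modn_small.
case: k => m; elim: m => [|m IH] h; first by rewrite (_ : Ordinal h = ord0) //; apply: val_inj.
by apply: connect_trans (IH (ltnW h)) _; rewrite (Ek m (ltnW h)); apply: connect1.
Qed.

Lemma cell_chain : hexagonal_chain cell_adj [set cell_edges (val i) | i : 'I_n.+1]
  turn n.+1 cell_edges (fun i => p i) (fun i => q i) (fun i => a i) (fun i => b i).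
Proof.
split.
- exact: cell_adj_sym.
- exact: cell_adj_irr.
- move=> i iN; apply/subsetP => e /imsetP[k _ ->].
  by rewrite edge_adj ?cell_adj_ordS //; [exact: cell_adj_sym|exact: cell_adj_irr].
- move=> i iN x y /cover_cell_edges[k ->] /cover_cell_edges[l ->].
  have es : symmetric (edge_rel (cell_edges i)) by exact: edge_rel_sym.
  have step m : edge_rel (cell_edges i) (cell_corner i m) (cell_corner i (ordS m)).
    by apply/imsetP; exists m.
  have cn := cell_corner_connect _ es step; apply: connect_trans (cn l).
  by rewrite (sym_connect_sym es).
- by [].
- exact: cover_cell_roles.
- apply/setP => x; rewrite in_setT; have [i [k [iN ->]]] := cell_vertexP x.
  apply: (subsetP (left_sub _ _ _ _ iN)).
  have : cell_corner i k \in cover (cell_edges i) by apply/cover_cell_edges; exists k.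
  rewrite (cover_cell_roles iN); move: (cell_corner i k); apply/subsetP.
  rewrite [left_part _ _ _ _ i.+1]/left_part /=; do 2!apply: setSU.
  exact: (rung_left (fun i => p i) (fun i => q i) (fun i => a i) (fun i => b i)  i).
- move=> i iN; apply/allP => x xr.
  have : x \in [seq vtx (corner i k) | k <- drop 2 (role i)].
    by rewrite map_drop role_vtx.
  by case/mapP => k kr ->; apply: role_new.
- by move=> i /role_uniq /and3P[].
- move=> i iN; have rung_adj j (k : 'I_6) z w : (j < n.+1)%N -> z = corner j k -> w = corner j (ordS k) ->
      cell_adj (vtx z) (vtx w).
    by move=> jN -> ->; apply: cell_adj_ordS.
  case: i iN => [_|i iN].
    rewrite /rung_top /rung_bot; case: (dir 0).
      exact: (rung_adj 0%N (@Ordinal 6 3 isT)).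
    exact: (rung_adj 0%N (@Ordinal 6 2 isT)).
  rewrite cell_adj_sym rung_topS rung_botS; case: (dir i.+1).
    exact: (rung_adj i (@Ordinal 6 0 isT)).
  exact: (rung_adj i (@Ordinal 6 5 isT)).
- move=> i iN; rewrite /turn /mid_a /mid_b.
  case: (dir i); case: (dir i.+1) => // _.
    by rewrite cell_adj_sym; exact: (cell_adj_ordS (@Ordinal 6 1 isT)).
  exact: (cell_adj_ordS (@Ordinal 6 4 isT)).
- move=> i iN ti x.
  have k6 : (mid_a i < 6)%N by rewrite /mid_a; case: (dir i); case: (dir i.+1).
  rewrite (mid_adj x iN (k := Ordinal k6) ti) ?inE ?eqxx //= rung_topS.
  rewrite /rung_top -/(corner _ _); move: ti; rewrite /turn /cell_corner /mid_a /=.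
  by case: (dir i); case: (dir i.+1).
- move=> i iN ti x.
  have k6 : (mid_b i < 6)%N by rewrite /mid_b; case: (dir i); case: (dir i.+1).
  rewrite (mid_adj x iN (k := Ordinal k6) ti) ?inE ?eqxx ?orbT //=  rung_botS.
  rewrite /rung_bot -/(corner _ _); move: ti; rewrite /turn /cell_corner /mid_b /=.
  by case: (dir i); case: (dir i.+1) => //= _; rewrite orbC.
Qed.
End Lattice.

(** * Connectivity of hexagonal chains *)

Section CutVertex.
Variables (dir : nat -> bool) (n : nat).
Local Notation T := (cell_vertex dir n).
Local Notation adj := (@cell_adj dir n).
Local Notation cc := (@cell_corner dir n).
Implicit Types (x y w : T).

Lemma delete_sym w : symmetric (delete_vertex adj w).
Proof. by move=> x y; rewrite /delete_vertex /= cell_adj_sym andbCA. Qed.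

Lemma iter_ordS j (k : 'I_6) : val (iter j (@ordS 6) k) = ((k + j) %% 6)%N.
Proof.
elim: j => [|j IH] /=; first by rewrite addn0 modn_small.
by rewrite IH; lia.
Qed.

(** Deleting a vertex from a hexagon leaves a path. *)
Lemma cell_delete_connect i w x y : (i < n.+1)%N ->
  x \in cover (cell_edges dir n i) -> y \in cover (cell_edges dir n i) ->
  x != w -> y != w -> connect (delete_vertex adj w) x y.
Proof.
move=> iN /cover_cell_edges[k ->] /cover_cell_edges[l ->] xw yw.
have [k0 k0P] : exists k0, forall m, (m != k0) -> cc i m != w.
  have [/existsP[k0 /eqP E]|none] := boolP [exists m, cc i m == w].
    by exists k0 => m; rewrite -E (inj_eq (cell_corner_inj iN)).
  by exists ord0 => m _; move/existsPn: none; apply.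
(* [u 0], ..., [u 4] run around the hexagon from one neighbour of the deleted
   corner to the other. *)
pose u j := iter j.+1 (@ordS 6) k0.
have u_neq j : (j <= 4)%N -> cc i (u j) != w.
  move=> j4; apply: k0P; apply/eqP => /(congr1 val); rewrite iter_ordS.
  by move=> /=; have := ltn_ord k0; lia.
have path_u j : (j <= 4)%N -> connect (delete_vertex adj w) (cc i (u 0)) (cc i (u j)).
  elim: j => // j IH j4; apply: connect_trans (IH (ltnW j4)) _; apply: connect1.
  by rewrite /delete_vertex /= u_neq 1?ltnW // (u_neq j.+1) //= cell_adj_ordS.
have reach m : cc i m != w -> connect (delete_vertex adj w) (cc i (u 0)) (cc i m).
  move=> mw; have [mk0|mk0] := eqVneq m k0.
    rewrite mk0 in mw *; apply: connect1; rewrite /delete_vertex /= u_neq // mw /=.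
    by rewrite cell_adj_sym cell_adj_ordS.
  pose j := ((m + 5 - k0) %% 6)%N.
  have j4 : (j <= 4)%N.
    have : (m : nat) <> k0 by move=> E; move/eqP: mk0; apply; apply: val_inj.
    by have := ltn_ord m; have := ltn_ord k0; rewrite /j; lia.
  suff -> : m = u j by exact: path_u.
  apply: val_inj; rewrite iter_ordS /j /=; have := ltn_ord m; have := ltn_ord k0; lia.
by apply: connect_trans (reach l yw); rewrite (sym_connect_sym (@delete_sym w)) reach.
Qed.

(** Consecutive hexagons share two vertices, one of which survives
    the deletion. *)
Lemma cell_delete_connected w x y : x != w -> y != w ->
  connect (delete_vertex adj w) x y.
Proof.
have ch := cell_chain dir n.
pose p i := vtx dir n (rung_top dir i); pose q i := vtx dir n (rung_bot dir i).
pose r i := if p i == w then q i else p i.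
have rw i : (i < n.+1)%N -> r i != w.
  rewrite /r => iN; case: ifP => [/eqP <-|/negbT//]; apply/eqP => E.
  by have := chain_rung ch (ltnW iN); rewrite -/(p i) -/(q i) E cell_adj_irr.
have r_in i : (i < n.+1)%N -> r i \in cover (cell_edges dir n i).
  by move=> iN; rewrite (chain_cover ch iN) /r !inE; case: ifP; rewrite eqxx ?orbT.
have r_inS i : (i < n.+1)%N -> r i.+1 \in cover (cell_edges dir n i).
  by move=> iN; rewrite (chain_cover ch iN) /r !inE; case: ifP; rewrite eqxx ?orbT.
have reach0 i : (i < n.+1)%N -> connect (delete_vertex adj w) (r 0) (r i).
  elim: i => // i IH iN; have iN' := ltnW iN; apply: connect_trans (IH iN') _.
  by apply: (@cell_delete_connect i); rewrite ?r_in ?r_inS ?rw.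
have reach z : z != w -> connect (delete_vertex adj w) (r 0) z.
  move=> zw; have [i [k [iN E]]] := cell_vertexP z.
  apply: connect_trans (reach0 i iN) _; apply: (@cell_delete_connect i) => //.
  - exact: r_in.
  - by apply/cover_cell_edges; exists k.
  - exact: rw.
move=> xw yw; apply: connect_trans (reach y yw).
by rewrite (sym_connect_sym (@delete_sym w)) reach.
Qed.

Lemma cell_no_cut_vertex w : ~ cut_vertex adj w.
Proof. by case=> x [y [xw yw _ /negP]]; apply; apply: cell_delete_connected. Qed.

Lemma cell_connected_graph : connected_graph adj.
Proof.
split; first by apply/card_gt0P; exists (cc 0 ord0).
move=> x y; have [->|xy] := eqVneq x y; first exact: connect0.
(* Any third vertex will do: the chain stays connected even without it. *)
have [w /andP[wx wy]] : exists w, (w != x) && (w != y).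
  apply/existsP; apply: contraT; rewrite negb_exists => /forallP H.
  have sub : cover (cell_edges dir n 0) \subset [set x; y].
    apply/subsetP => w _; have := H w; rewrite negb_and !negbK !inE //.
  have := subset_leq_card sub; rewrite cards2 xy.
  have -> : cover (cell_edges dir n 0) = [set cc 0 k | k : 'I_6].
    apply/setP => z; apply/cover_cell_edges/imsetP => [[k ->]|[k _ ->]]; by exists k.
  by rewrite card_imset ?cardsT ?card_ord //; apply: cell_corner_inj.
have := @cell_delete_connected w x y; rewrite !(eq_sym _ w) => /(_ wx wy).
by apply: connect_sub => a b /and3P[_ _ ab]; apply: connect1.
Qed.

End CutVertex.

From mathcomp Require Import all_classical all_reals all_analysis.
Import Order.TTheory GRing.Theory Num.Theory numFieldNormedType.Exports.
Local Open Scope classical_set_scope.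
Local Open Scope ring_scope.

(** * Zeros of the transfer recursion *)

Definition period_kink (m i : nat) : bool := (m.+1 %| i.+1)%N.

Section Period.
Variables (R : comNzRingType) (x : R) (m : nat).
Local Notation W := (weights x (period_kink m)).

(** Only one of the hexagons between two kinks can be chosen, and only if the chain is
    unblocked at the beginning. *)
Lemma weights_block n j : (j <= m)%N ->
  W (n * m.+1 + j) = ((W (n * m.+1)).1, (W (n * m.+1)).2 + x *+ j * (W (n * m.+1)).1).
Proof.
elim: j => [|j IH] jm; first by rewrite addn0 mulr0n mul0r addr0 -surjective_pairing.
rewrite addnS weightsS IH; last exact: ltnW.
have -> : period_kink m (n * m.+1 + j) = false.
  rewrite /period_kink -addnS dvdn_addr ?dvdn_mull //.
  by apply/negbTE/negP => /dvdn_leq; lia.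
case: (W (n * _)) => f k /=; congr (_, _); rewrite [x *+ j.+1]mulrS; ring.
Qed.

Lemma weights_period n :
  W (n.+1 * m.+1) =
    ((1 + x *+ m) * (W (n * m.+1)).1 + (W (n * m.+1)).2, x * (W (n * m.+1)).1).
Proof.
have -> : (n.+1 * m.+1 = (n * m.+1 + m).+1)%N by lia.
rewrite weightsS weights_block // /period_kink.
rewrite -addnS dvdn_addr ?dvdn_mull // dvdnn.
case: (W (n * _)) => f k /=; congr (_, _); rewrite -[x *+ m]mulr_natr; ring.
Qed.

(** The last of [n.+1 * m.+1] hexagons is a kink, which frees the chain if it
    is not chosen; the weight of the unblocked choices with it is the total weight without it. *)
Lemma weights_total n :
  (W (n.+1 * m.+1).-1).1 + (W (n.+1 * m.+1).-1).2 = (W (n.+1 * m.+1)).1.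
Proof.
have -> : (n.+1 * m.+1 = (n * m.+1 + m).+1)%N by lia.
rewrite [in RHS]weightsS /period_kink -addnS dvdn_addr ?dvdn_mull // dvdnn.
by rewrite addnS.
Qed.

End Period.

Section Zeros.
Variable R : realType.
Implicit Types (s th r : R).

(** The recursion with characteristic roots [s e^(i th)] and [s e^(- i th)]; the
    statement is multiplied by [sin th] to stay free of division. *)
Lemma weights_sin m s th : 1 - s ^+ 2 *+ m = 2 * s * cos th -> forall n,
  let W := weights (- s ^+ 2) (period_kink m) (n * m.+1) in
  W.1 * sin th = s ^+ n * sin (n.+1%:R * th) /\
  W.2 * sin th = - s ^+ n.+1 * sin (n%:R * th).
Proof.
move=> E; elim=> [|n [IH1 IH2]].
  by rewrite mul0n /= !mul1r !mul0r sin0 mulr0.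
rewrite weights_period /=; split; last by rewrite -mulrA IH1 !exprS; ring.
rewrite mulNrn E mulrDl -mulrA IH1 IH2.
have -> : n.+2%:R * th = n.+1%:R * th + th by rewrite -natr1; ring.
have -> : n%:R * th = n.+1%:R * th - th by rewrite -natr1; ring.
rewrite sinB sinD exprS; ring.
Qed.

Lemma weights_zero m s n k : (0 < k)%N -> (k < n.+1)%N ->
  1 - s ^+ 2 *+ m = 2 * s * cos (k%:R * pi / n.+1%:R) ->
  (weights (- s ^+ 2) (period_kink m) (n * m.+1)).1 = 0.
Proof.
move=> k0 kn /weights_sin /(_ n) [+ _].
have -> : n.+1%:R * (k%:R * pi / n.+1%:R) = k%:R * pi :> R.
  by rewrite mulrC divfK // pnatr_eq0.
have -> : sin (k%:R * pi) = 0 :> R.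
  by rewrite mulr_natl -[pi *+ k]add0r (alternatingn (@sinDpi R)) sin0 mulr0.
rewrite mulr0 => /eqP; rewrite mulf_eq0 => /orP[/eqP//|/eqP s0].
suff : 0 < sin (k%:R * pi / n.+1%:R : R) by rewrite s0 ltxx.
apply: sin_gt0_pi; rewrite divr_gt0 ?mulr_gt0 ?ltr0n ?pi_gt0 //=.
by rewrite ltr_pdivrMr ?ltr0n // mulrC ltr_pM2l ?pi_gt0 // ltr_nat.
Qed.

(** The positive root [s] of [m s^2 + 2 s cos th = 1], rationalised so that the formula
    also covers [m = 0]. *)
Definition root_of_angle m th : R :=
  (cos th + Num.sqrt (cos th ^+ 2 + m%:R))^-1.

Lemma root_of_angleP m th (s := root_of_angle m th) : 0 < s ->
  1 - s ^+ 2 *+ m = 2 * s * cos th.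
Proof.
rewrite /s /root_of_angle; set c := cos th; set q := Num.sqrt _ => d0.
have qE : q ^+ 2 = c ^+ 2 + m%:R by rewrite sqr_sqrtr // addr_ge0 ?sqr_ge0.
have d1 : c + q != 0 by rewrite -invr_eq0 gt_eqF.
rewrite -mulr_natr; have -> : m%:R = q ^+ 2 - c ^+ 2 by rewrite qE; ring.
by field.
Qed.

(** With [m] the integer part of [1 / s^2] one has [0 <= 1 - m s^2 < s^2], so
    the required cosine [(1 - m s^2) / (2 s)] is nonnegative and less than [s / 2]; if
    [s >= 2] then [m = 0] and the cosine is [1 / (2 s)]. *)
Lemma root_of_angle_onto s : 0 < s -> exists m th,
  [/\ 0 < th, th < pi & root_of_angle m th = s].
Proof.
move=> s0; have s20 : 0 < s ^+ 2 by rewrite exprn_gt0.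
pose m := Num.truncn (s ^+ 2)^-1; pose c := (1 - m%:R * s ^+ 2) / (2 * s).
have /andP[ml mu] : m%:R <= (s ^+ 2)^-1 < m.+1%:R.
  by apply: truncn_itv; rewrite invr_ge0 ltW.
have {}ml : m%:R * s ^+ 2 <= 1 by rewrite -ler_pdivlMr // div1r.
have {}mu : 1 < (m%:R + 1) * s ^+ 2 by rewrite natr1 -ltr_pdivrMr // div1r.
have cl : -1 < c by rewrite ltr_pdivlMr; nra.
have cu : c < 1.
  rewrite ltr_pdivrMr ?mul1r; last by lra.
  have [s2|s2] := ltrP s 2; first by nra.
  have : 0 <= m%:R * s ^+ 2 by rewrite mulr_ge0 ?ler0n ?ltW.
  by lra.
have c1 : -1 <= c <= 1 by rewrite !ltW.
exists m, (acos c); split.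
- by rewrite acos_gt0 // ltW.
- by rewrite acos_ltpi // cl ltW.
rewrite /root_of_angle acosK ?in_itv //=.
have -> : c ^+ 2 + m%:R = ((1 + m%:R * s ^+ 2) / (2 * s)) ^+ 2.
  by rewrite /c; field; rewrite gt_eqF.
rewrite sqrtr_sqr ger0_norm; last by rewrite divr_ge0 ?addr_ge0 ?mulr_ge0 ?ler0n ?ltW.
rewrite /c; field; rewrite gt_eqF //=; apply: lt0r_neq0; lra.
Qed.

Lemma continuous_root_of_angle m th : 0 < root_of_angle m th ->
  {for th, continuous (root_of_angle m)}.
Proof.
move=> d0; apply: cvgV; first by rewrite -invr_eq0 gt_eqF.
have cc : cos x @[x --> th] --> cos th by exact: continuous_cos.
apply: cvgD => //; apply: continuous_cvg; first exact: sqrt_continuous.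
by apply: cvgD; [rewrite expr2; under eq_fun do rewrite expr2; exact: cvgM|exact: cvg_cst].
Qed.

Lemma dense_rational_angles th (e : R) : 0 < th -> th < pi -> 0 < e ->
  exists n k, [/\ (2 <= n)%N, (0 < k)%N, (k < n.+1)%N & `|th - k%:R * pi / n.+1%:R| < e].
Proof.
move=> th0 thpi e0.
(* Steps shorter than [th] make sure that the angle found is not 0. *)
pose d := Num.min e th.
have d0 : 0 < d by rewrite lt_min e0.
pose n := (Num.truncn (pi / d)).+2; have pi0 := pi_gt0 R.
have n0 : 0 < n.+1%:R :> R by rewrite ltr0n.
have nd : pi / n.+1%:R < d.
  rewrite ltr_pdivrMr // mulrC -ltr_pdivrMr //.
  have /andP[_ h] : (Num.truncn (pi / d))%:R <= pi / d < (Num.truncn (pi / d)).+1%:R.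
    by apply: truncn_itv; rewrite divr_ge0 ?ltW.
  by apply: lt_trans h _; rewrite ltr_nat.
pose k := Num.truncn (th * n.+1%:R / pi).
have /andP[kl ku] : k%:R <= th * n.+1%:R / pi < k.+1%:R.
  by apply: truncn_itv; rewrite divr_ge0 ?mulr_ge0 ?ler0n ?ltW.
have {}kl : k%:R * pi / n.+1%:R <= th by rewrite ler_pdivrMr // -ler_pdivlMr.
have {}ku : th < k%:R * pi / n.+1%:R + pi / n.+1%:R.
  by rewrite -mulrDl -[X in _ + X]mul1r -mulrDl natr1 ltr_pdivlMr // -ltr_pdivrMr.
have de : d <= e by rewrite ge_min lexx.
have dth : d <= th by rewrite ge_min lexx orbT.
exists n, k; split => //.
- rewrite lt0n; apply/eqP => k0; move: ku; rewrite k0 !mul0r add0r => ku.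
  by have := lt_le_trans (lt_trans ku nd) dth; rewrite ltxx.
- rewrite -(ltr_nat R) -(ltr_pM2r pi0) [ltRHS]mulrC -ltr_pdivrMr //.
  exact: le_lt_trans kl thpi.
- rewrite ger0_norm ?subr_ge0 // ltrBlDl; apply: lt_le_trans ku _.
  by rewrite lerD2l (le_trans (ltW nd)).
Qed.

Lemma weights_zeros_dense (al be : R) : 0 <= al -> al < be ->
  exists s m n, [/\ al < s, s < be, (2 <= n)%N &
    (weights (- s ^+ 2) (period_kink m) (n * m.+1)).1 = 0].
Proof.
move=> al0 albe; pose s0 := (al + be) / 2.
have [als sbe] : al < s0 /\ s0 < be by rewrite /s0; lra.
have s00 : 0 < s0 by lra.
have [m [th [th0 thpi E]]] := root_of_angle_onto s00.
have cont : root_of_angle m x @[x --> th] --> s0.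
  by rewrite -E; apply: continuous_root_of_angle; rewrite E.
have near_s : \forall x \near th, al < root_of_angle m x < be.
  have : nbhs s0 [set y | al < y < be].
    have : s0 \in `]al, be[ by rewrite in_itv /= als.
    move=> /near_in_itvoo; apply: filterS => y; by rewrite in_itv.
  by move=> /cont.
have /nbhs_ballP[e /= e0 ball_e] := near_s.
have [n [k [n2 k0 kn ke]]] := dense_rational_angles th0 thpi e0.
have /andP[sl su] := ball_e _ ke.
exists (root_of_angle m (k%:R * pi / n.+1%:R)), m, n; split => //.
by apply: (weights_zero k0 kn); apply: root_of_angleP; lra.
Qed.

End Zeros.

(** * Lattice cells in the plane *)

Section Coordinates.
Variable R : realType.
Implicit Types (p : R * R) (z w y : int * int) (t u v : R).

Lemma sin_pi3_gt0 : 0 < sin (pi / 3) :> R.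
Proof. by apply: sin_gt0_pi; have := pi_gt0 R; lra. Qed.

Lemma cos_pi3 : cos (pi / 3) = 1 / 2 :> R.
Proof.
have s0 := sin_pi3_gt0; set t : R := pi / 3 in s0 *.
have c0 : 0 < cos t by apply: cos_gt0_pihalf; rewrite /t; have := pi_gt0 R; lra.
have : sin (t + (t + t)) = 0.
  by rewrite (_ : t + (t + t) = pi) ?sinpi // /t; lra.
rewrite sinD (cosD t t) (sinD t t) => E.
have sc := cos2Dsin2 t.
have : sin t * ((2 * cos t - 1) * (2 * cos t + 1)) = 0.
  transitivity (sin t * (cos t * cos t - sin t * sin t) +
    cos t * (sin t * cos t + cos t * sin t) + sin t * (cos t ^+ 2 + sin t ^+ 2 - 1)).
    by ring.
  by rewrite E sc subrr mulr0 addr0.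
move/eqP; rewrite mulf_eq0 gt_eqF //= mulf_eq0 => /orP[] /eqP; lra.
Qed.

(** The distance [sqrt 3 / 2] between consecutive rows of the lattice. *)
Definition row_height : R := sin (pi / 3).
Local Notation h := row_height.

Lemma row_height_gt0 : 0 < h.
Proof. exact: sin_pi3_gt0. Qed.
Let h0 := row_height_gt0.

Lemma row_height_sqr : h * h = 3 / 4.
Proof. by have := cos2Dsin2 (pi / 3 : R); rewrite cos_pi3 -/h => E; lra. Qed.

(** The lattice point with coordinates [z] in the plane; [coord_u] and [coord_v] recover
    lattice coordinates from plane ones. *)
Definition plane_point z : R * R := (z.1%:~R + z.2%:~R / 2, z.2%:~R * h).
Definition coord_u p : R := p.1 - p.2 / h / 2.
Definition coord_v p : R := p.2 / h.

Lemma coord_u_point z : coord_u (plane_point z) = z.1%:~R.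
Proof. by rewrite /coord_u /= mulfK ?gt_eqF //; ring. Qed.

Lemma coord_v_point z : coord_v (plane_point z) = z.2%:~R.
Proof. by rewrite /coord_v /= mulfK ?gt_eqF. Qed.

Lemma coord_inj p q : coord_u p = coord_u q -> coord_v p = coord_v q -> p = q.
Proof.
case: p q => [x y] [x' y'] /=; rewrite /coord_u /coord_v /= => + E.
by rewrite E => /addIr ->; rewrite -[y](divfK (lt0r_neq0 h0)) E divfK ?lt0r_neq0.
Qed.

Lemma plane_point_inj : injective plane_point.
Proof.
move=> [a b] [c d] E; have := coord_u_point (a, b); have := coord_v_point (a, b).
by rewrite E coord_u_point coord_v_point /= => /intr_inj -> /intr_inj ->.
Qed.

Lemma hexagon_position (k : 'I_6) :
  plane_point (hexdir k) = (cos (k%:R * (pi / 3)), sin (k%:R * (pi / 3))).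
Proof.
have hE := row_height_sqr.
pose turned (j : nat) (x y : R) :=
  cos (j%:R * (pi / 3)) = x /\ sin (j%:R * (pi / 3)) = y.
have step j (x y x' y' : R) : turned j x y -> x / 2 - y * h = x' -> y / 2 + x * h = y' ->
    turned j.+1 x' y'.
  case=> cE sE <- <-; rewrite /turned -natr1 mulrDl mul1r cosD sinD cE sE cos_pi3.
  by rewrite div1r.
have e0 : turned 0%N 1 0 by rewrite /turned mul0r cos0 sin0.
have e1 : turned 1%N (1 / 2) h by apply: step e0 _ _; lra.
have e2 : turned 2%N (- (1 / 2)) h by apply: step e1 _ _; lra.
have e3 : turned 3%N (- 1) 0 by apply: step e2 _ _; lra.
have e4 : turned 4%N (- (1 / 2)) (- h) by apply: step e3 _ _; lra.
have e5 : turned 5%N (1 / 2) (- h) by apply: step e4 _ _; lra.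
case: k => -[|[|[|[|[|[|k]]]]]] lt_k6 //; rewrite /plane_point /=;
  [case: e0|case: e1|case: e2|case: e3|case: e4|case: e5] => -> ->;
  congr (_, _); lra.
Qed.

Lemma plane_pointD z w : plane_point (z + w) =
  ((plane_point z).1 + (plane_point w).1, (plane_point z).2 + (plane_point w).2).
Proof. by congr (_, _); rewrite /= !intrD; ring. Qed.

Lemma plane_segmentP p z w :
  plane_segment (plane_point z) (plane_point w) p <->
  exists2 t, 0 <= t <= 1 &
    coord_u p = (1 - t) * z.1%:~R + t * w.1%:~R /\ coord_v p = (1 - t) * z.2%:~R + t * w.2%:~R.
Proof.
split=> [[t /=]|[t t01 [uE vE]]].
  rewrite in_itv /= => t01 <-; exists t => //.
  by rewrite /coord_u /coord_v /=; split; field; exact: lt0r_neq0.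
exists t; first by rewrite /= in_itv.
apply: coord_inj.
  by rewrite uE /coord_u /=; field; exact: lt0r_neq0.
by rewrite vE /coord_v /=; field; exact: lt0r_neq0.
Qed.

(** A regular hexagon of side 1 in lattice coordinates. *)
Definition in_cell u v : bool := [&& -1 < u < 1, -1 < v < 1 & -1 < u + v < 1].
Definition in_cell_closed u v : bool :=
  [&& -1 <= u <= 1, -1 <= v <= 1 & -1 <= u + v <= 1].

Definition open_cell z : set (R * R) :=
  [set p | in_cell (coord_u p - z.1%:~R) (coord_v p - z.2%:~R)].
Definition closed_cell z : set (R * R) :=
  [set p | in_cell_closed (coord_u p - z.1%:~R) (coord_v p - z.2%:~R)].

Definition unit_step z w : Prop := exists2 k, (k < 6)%N & w = z + hexdir k.

Lemma unit_step_sym z w : unit_step z w -> unit_step w z.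
Proof.
case=> k k6 ->; exists ((k + 3) %% 6)%N; first by rewrite ltn_mod.
rewrite -addrA -[LHS]addr0; congr (_ + _).
by move: k6; case: k => [|[|[|[|[|[|k]]]]]].
Qed.

(** The form in which integrality enters: a coordinate that moves by [d] along a unit
    edge can be close to an integer only if this integer is one of its two end values. *)
Lemma pin_end t (d m : int) : 0 < t -> t < 1 -> (-1 <= d <= 1) ->
  -1 < t * d%:~R - m%:~R -> t * d%:~R - m%:~R < 1 -> m = 0 \/ m = d.
Proof.
move=> t0 t1 dr.
have bd (lo hi : int) : lo%:~R < m%:~R :> R -> m%:~R < hi%:~R :> R -> lo < m < hi.
  by rewrite !ltr_int => -> ->.
have [->|[->|->]] : d = 0 \/ d = 1 \/ d = -1 by clear -dr; lia.
- move=> lb ub; have : -1 < m < 1 by apply: bd; rewrite ?mulrN1z; lra.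
  by clear; lia.
- move=> lb ub; have : -1 < m < 2 by apply: bd; rewrite ?mulrN1z; lra.
  by clear; lia.
- move=> lb ub; have : -2 < m < 1 by apply: bd; rewrite ?mulrNz; lra.
  by clear; lia.
Qed.

Lemma int_zero (m : int) : -1 < m%:~R :> R -> m%:~R < 1 :> R -> m = 0.
Proof.
move=> lb ub; have : m%:~R < 1%:~R :> R by [].
have : (-1)%:~R < m%:~R :> R by rewrite mulrN1z.
by rewrite !ltr_int; clear; lia.
Qed.

(** Each of the three coordinates [u], [v], [u + v] moves by at most one along a
    unit edge, so it pins the corresponding coordinate of [y] to one of its values at the
    ends. *)
Lemma near_unit_edge z w y t p : unit_step z w -> 0 < t < 1 ->
  coord_u p = (1 - t) * z.1%:~R + t * w.1%:~R ->
  coord_v p = (1 - t) * z.2%:~R + t * w.2%:~R ->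
  open_cell y p -> y = z \/ y = w.
Proof.
move=> [k k6 ->] /andP[t0 t1] uE vE /= /and3P[/andP[u1 u2] /andP[v1 v2] /andP[s1 s2]].
have pin := pin_end t0 t1.
have dir_bound : [/\ -1 <= (hexdir k).1 <= 1, -1 <= (hexdir k).2 <= 1 &
    -1 <= (hexdir k).1 + (hexdir k).2 <= 1].
  by move: k6; case: k {uE vE} => [|[|[|[|[|[|k]]]]]].
have [b1 b2 b3] := dir_bound.
rewrite uE vE /= !intrD in u1 u2 v1 v2 s1 s2.
have P1 := pin _ (y.1 - z.1) b1; rewrite intrB in P1.
have P2 := pin _ (y.2 - z.2) b2; rewrite intrB in P2.
have P3 := pin _ (y.1 - z.1 + (y.2 - z.2)) b3; rewrite !(intrD, intrB) in P3.
have {}P1 : y.1 - z.1 = 0 \/ y.1 - z.1 = (hexdir k).1 by apply: P1; lra.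
have {}P2 : y.2 - z.2 = 0 \/ y.2 - z.2 = (hexdir k).2 by apply: P2; lra.
have {}P3 : y.1 - z.1 + (y.2 - z.2) = 0 \/
    y.1 - z.1 + (y.2 - z.2) = (hexdir k).1 + (hexdir k).2 by apply: P3; lra.
clear -P1 P2 P3 k6; case: y z P1 P2 P3 => [y1 y2] [z1 z2] /= P1 P2 P3.
suff : (y1 = z1 /\ y2 = z2) \/ (y1 = z1 + (hexdir k).1 /\ y2 = z2 + (hexdir k).2).
  by case=> -[-> ->]; [left|right].
move: k6 P1 P2 P3; case: k => [|[|[|[|[|[|k]]]]]] //= _; lia.
Qed.

Lemma unit_edge_near z w p t : unit_step z w -> 0 <= t < 1 ->
  coord_u p = (1 - t) * z.1%:~R + t * w.1%:~R ->
  coord_v p = (1 - t) * z.2%:~R + t * w.2%:~R ->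
  open_cell z p.
Proof.
move=> [k k6 ->] /andP[t0 t1]; rewrite /open_cell /in_cell /= => -> ->.
rewrite !intrD.
(* Relative to [z] the point is [t] times a unit vector, and [t < 1]. *)
have shift (x d : R) : (1 - t) * x + t * (x + d) - x = t * d by ring.
rewrite !shift.
by move: k6; case: k => [|[|[|[|[|[|k]]]]]] //= _;
  rewrite ?mulrN1z; apply/and3P; split; apply/andP; split; lra.
Qed.

Lemma plane_segment_interior z w p : plane_segment (plane_point z) (plane_point w) p ->
  p <> plane_point z -> p <> plane_point w ->
  exists2 t, 0 < t < 1 & coord_u p = (1 - t) * z.1%:~R + t * w.1%:~R /\ coord_v p = (1 - t) * z.2%:~R + t * w.2%:~R.
Proof.
move=> /plane_segmentP[t /andP[t0 t1] [uE vE]] pz pw; exists t => //.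
rewrite !lt_neqAle t0 t1 !andbT; apply/andP; split; apply/eqP => E.
  by apply: pz; apply: coord_inj; rewrite ?uE ?vE ?coord_u_point ?coord_v_point -E; ring.
by apply: pw; apply: coord_inj; rewrite ?uE ?vE ?coord_u_point ?coord_v_point E; ring.
Qed.

(** A lattice point lies in no open cell but its own. *)
Lemma plane_point_open_cell z w : open_cell z (plane_point w) -> z = w.
Proof.
rewrite /open_cell /= coord_u_point coord_v_point /in_cell -!intrB -intrD.
case/and3P => /andP[u1 u2] /andP[v1 v2] _.
have := int_zero u1 u2; have := int_zero v1 v2.
by case: z w {u1 u2 v1 v2} => [z1 z2] [w1 w2] /= E1 E2; congr (_, _); lia.
Qed.

End Coordinates.

(** * Drawing a hexagonal chain *)

Section Segments.
Variable R : realType.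
Implicit Types (p q : R * R) (z w y : int * int).

Lemma plane_segmentC p q : plane_segment p q = plane_segment q p.
Proof.
suff sub (a b : R * R) : plane_segment a b `<=` plane_segment b a.
  by apply/seteqP; split; exact: sub.
move=> _ [t /= t01 <-]; exists (1 - t) => /=.
  by move: t01; rewrite !in_itv /= => /andP[? ?]; apply/andP; split; lra.
by congr (_, _); ring.
Qed.

Lemma affine_path_continuous p q :
  continuous (fun t : R => ((1 - t) * p.1 + t * q.1, (1 - t) * p.2 + t * q.2) : R * R).
Proof.
have aff (a b : R) : continuous (fun t : R => (1 - t) * a + t * b).
  move=> t; apply: cvgD; last by apply: cvgMl; exact: cvg_id.
  by apply: cvgMl; apply: cvgB; [exact: cvg_cst|exact: cvg_id].
by move=> t; exact: (cvg_pair (aff p.1 q.1 t) (aff p.2 q.2 t)).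
Qed.

Lemma plane_segment_arc p q : p <> q -> plane_arc p q (plane_segment p q).
Proof.
move=> pq; exists (fun t => ((1 - t) * p.1 + t * q.1, (1 - t) * p.2 + t * q.2)); split.
- exact/continuous_subspaceT/affine_path_continuous.
- move=> s t _ _ [E1 E2]; apply/eqP; apply: contraT => st.
  have st0 : s - t != 0 by rewrite subr_eq0.
  case: pq; case: p q E1 E2 => [p1 p2] [q1 q2] /= E1 E2.
  congr (_, _); apply: (mulfI st0); lra.
- by rewrite subr0 !mul1r !mul0r !addr0 -surjective_pairing.
- by rewrite subrr !mul1r !mul0r !add0r -surjective_pairing.
- by [].
Qed.

(** The converse of [plane_point_open_cell]. *)
Lemma open_cell_point z : open_cell z (plane_point R z).
Proof.
by rewrite /open_cell /in_cell /= coord_u_point coord_v_point !subrr addr0 ltrN10 ltr01.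
Qed.

Lemma segment_open_cell z w p : unit_step z w ->
  plane_segment (plane_point R z) (plane_point R w) p -> p <> plane_point R w ->
  open_cell z p.
Proof.
move=> zw /plane_segmentP[t /andP[t0 t1] [uE vE]] pw.
apply: (unit_edge_near zw _ uE vE); rewrite t0 lt_neqAle t1 andbT /=; apply/eqP => E.
by apply: pw; apply: coord_inj; rewrite ?uE ?vE ?coord_u_point ?coord_v_point E; ring.
Qed.

Lemma segment_point_near z w y p : unit_step z w ->
  plane_segment (plane_point R z) (plane_point R w) p ->
  p <> plane_point R z -> p <> plane_point R w ->
  open_cell y p -> y = z \/ y = w.
Proof.
move=> zw ps pz pw; have [t t01 [uE vE]] := plane_segment_interior ps pz pw.
exact: near_unit_edge zw t01 uE vE.
Qed.

(** An interior point of an edge lies in the open cells of both ends of any unit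
    edge that contains it, and those can only be the ends of the first edge. *)
Lemma unit_edge_determined z w z' w' p : unit_step z w -> unit_step z' w' ->
  plane_segment (plane_point R z) (plane_point R w) p ->
  p <> plane_point R z -> p <> plane_point R w ->
  plane_segment (plane_point R z') (plane_point R w') p ->
  (z' = z /\ w' = w) \/ (z' = w /\ w' = z).
Proof.
move=> zw zw' ps pz pw ps'.
have near y := @segment_point_near z w y p zw ps pz pw.
have notpt y : p <> plane_point R y.
  move=> E; have : open_cell y p by rewrite E; exact: open_cell_point.
  by case/near => yE; [apply: pz|apply: pw]; rewrite E yE.
have z'near := near _ (segment_open_cell zw' ps' (notpt _)).
have w'near : w' = z \/ w' = w.
  apply: near; apply: (segment_open_cell (unit_step_sym zw')) (notpt _).
  by rewrite plane_segmentC.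
have ne : z' <> w'.
  case: zw' => k k6 -> E; have : hexdir k = 0 by apply: (addrI z'); rewrite -E addr0.
  by move: k6 {E}; case: k => [|[|[|[|[|[|k]]]]]].
by case: z'near ne => ->; case: w'near => -> //; [left|right].
Qed.

End Segments.

Section ChainGraph.
Variables (R : realType) (dir : nat -> bool) (n : nat).
Local Notation T := (cell_vertex dir n).
Local Notation adj := (@cell_adj dir n).
Implicit Types x y z w : T.

Definition chain_position x : R * R := plane_point R (val x).
Definition chain_curve x y : set (R * R) :=
  plane_segment (chain_position x) (chain_position y).

Lemma corner_step i (k : 'I_6) : unit_step (corner dir i k) (corner dir i (ordS k)).
Proof.
exists ((k + 2) %% 6)%N; first by rewrite ltn_mod.
rewrite /corner -addrA; congr (_ + _).
by case: k => -[|[|[|[|[|[|k]]]]]].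
Qed.

Lemma cell_adj_step x y : adj x y -> unit_step (val x) (val y).
Proof.
move=> /cell_adjP[i [k [iN [[-> ->]|[-> ->]]]]]; rewrite !val_cell_corner //.
  exact: corner_step.
by apply: unit_step_sym; exact: corner_step.
Qed.

Lemma chain_position_inj : injective chain_position.
Proof. by move=> x y /plane_point_inj/val_inj. Qed.

Lemma chain_curve_arc x y : adj x y ->
  plane_arc (chain_position x) (chain_position y) (chain_curve x y).
Proof.
move=> xy; apply: plane_segment_arc => /chain_position_inj E.
by move: xy; rewrite E cell_adj_irr.
Qed.

Lemma chain_curve_vertex x y z : adj x y ->
  ~ (chain_curve x y `\` [set chain_position x; chain_position y]) (chain_position z).
Proof.
move=> xy [zs /not_orP[zx zy]].
have := segment_point_near (cell_adj_step xy) zs zx zy (open_cell_point _ _).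
by case=> /val_inj E; [apply: zx|apply: zy]; rewrite E.
Qed.

Lemma chain_curve_disjoint x y z w : adj x y -> adj z w ->
  ([set x; y] <> [set z; w])%SET ->
  (chain_curve x y `\` [set chain_position x; chain_position y]) `&` chain_curve z w = set0.
Proof.
move=> xy zw ne; apply/seteqP; split=> // p [[ps /not_orP[px py]] ps']; apply: ne.
have := unit_edge_determined (cell_adj_step xy) (cell_adj_step zw) ps px py ps'.
by case=> -[/val_inj -> /val_inj ->] //; rewrite finset.setUC.
Qed.

Definition chain_graph : plane_graph R :=
  @PlaneGraph R T adj chain_position chain_curve (@cell_adj_sym dir n)
    (@cell_adj_irr dir n) chain_position_inj (fun x y _ => plane_segmentC _ _)
    chain_curve_arc chain_curve_vertex chain_curve_disjoint.

End ChainGraph.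

(** * Topology of a cell *)

Section CellTopology.
Variable R : realType.
Implicit Types (p q : R * R) (z w y : int * int).

Lemma in_cell_closedW (u v : R) : in_cell u v -> in_cell_closed u v.
Proof.
by move=> /and3P[/andP[? ?] /andP[? ?] /andP[? ?]]; apply/and3P; split; apply/andP; split; lra.
Qed.

Lemma open_closed_cell z : open_cell z `<=` closed_cell (R := R) z.
Proof. by move=> p; exact: in_cell_closedW. Qed.

Lemma linear_form_continuous (a b : R) : continuous (fun p => a * p.1 + b * p.2).
Proof.
move=> p; apply: cvgD; apply: cvgMl_tmp; [exact: cvg_fst|exact: cvg_snd].
Qed.

Lemma coord_u_continuous : continuous (@coord_u R).
Proof.
rewrite (_ : @coord_u R = fun p => 1 * p.1 + (- (row_height R)^-1 / 2) * p.2).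
  exact: linear_form_continuous.
by apply/funext => p; rewrite /coord_u; ring.
Qed.

Lemma coord_v_continuous : continuous (@coord_v R).
Proof.
rewrite (_ : @coord_v R = fun p => 0 * p.1 + (row_height R)^-1 * p.2).
  exact: linear_form_continuous.
by apply/funext => p; rewrite /coord_v; ring.
Qed.

Let cu z p : R := coord_u p - z.1%:~R.
Let cv z p : R := coord_v p - z.2%:~R.

Let cuC z : continuous (cu z).
Proof. by move=> p; apply: cvgB; [exact: coord_u_continuous|exact: cvg_cst]. Qed.
Let cvC z : continuous (cv z).
Proof. by move=> p; apply: cvgB; [exact: coord_v_continuous|exact: cvg_cst]. Qed.
Let cwC z : continuous (fun p => cu z p + cv z p).
Proof. by move=> p; apply: cvgD; [exact: cuC|exact: cvC]. Qed.

Lemma open_cell_open z : open (open_cell (R := R) z).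
Proof.
rewrite (_ : open_cell z = cu z @^-1` `]-1, 1[ `&` (cv z @^-1` `]-1, 1[ `&`
    (fun p => cu z p + cv z p) @^-1` `]-1, 1[)).
  apply: openI; first by apply: open_comp => // p _; exact: cuC.
  apply: openI; first by apply: open_comp => // p _; exact: cvC.
  by apply: open_comp => // p _; exact: cwC.
apply/seteqP; split=> p; rewrite /open_cell /in_cell /= !in_itv /=.
  by move=> /and3P[].
by move=> [? [? ?]]; apply/and3P.
Qed.

Lemma closed_cell_closed z : closed (closed_cell (R := R) z).
Proof.
rewrite (_ : closed_cell z = cu z @^-1` `[-1, 1] `&` (cv z @^-1` `[-1, 1] `&`
    (fun p => cu z p + cv z p) @^-1` `[-1, 1])).
  apply: closedI; first by apply: preimage_closed; [move=> ? _; exact: cuC|exact: itv_closed].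
  apply: closedI; first by apply: preimage_closed; [move=> ? _; exact: cvC|exact: itv_closed].
  by apply: preimage_closed; [move=> ? _; exact: cwC|exact: itv_closed].
apply/seteqP; split=> p; rewrite /closed_cell /in_cell_closed /= !in_itv /=.
  by move=> /and3P[].
by move=> [? [? ?]]; apply/and3P.
Qed.

Definition affine_path p q (t : R) : R * R :=
  ((1 - t) * p.1 + t * q.1, (1 - t) * p.2 + t * q.2).

Lemma coord_affine_path p q t :
  coord_u (affine_path p q t) = (1 - t) * coord_u p + t * coord_u q /\
  coord_v (affine_path p q t) = (1 - t) * coord_v p + t * coord_v q.
Proof. by rewrite /coord_u /coord_v /=; split; ring. Qed.

Lemma shrink_to_center z p t : 0 < t <= 1 -> closed_cell z p ->
  open_cell z (affine_path p (plane_point R z) t).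
Proof.
move=> /andP[t0 t1] /and3P[/andP[u1 u2] /andP[v1 v2] /andP[w1 w2]].
have [uE vE] := coord_affine_path p (plane_point R z) t.
rewrite /open_cell /in_cell /= uE vE coord_u_point coord_v_point.
have E (a b : R) : (1 - t) * a + t * b - b = (1 - t) * (a - b) by ring.
rewrite !E -mulrDr.
have bd (x : R) : -1 <= x -> x <= 1 -> -1 < (1 - t) * x < 1.
  by move=> x1 x2; apply/andP; split; nra.
by apply/and3P; split; apply: bd.
Qed.

(** Shrinking a point of the closed cell slightly towards the center puts it
    in the open cell. *)
Lemma closure_open_cell z : closure (open_cell (R := R) z) = closed_cell z.
Proof.
apply/seteqP; split.
  rewrite [X in _ `<=` X](closure_id _).1; last exact: closed_cell_closed.
  exact/closureS/open_closed_cell.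
move=> p pz U Up.
have : nbhs (0 : R) (affine_path p (plane_point R z) @^-1` U).
  apply: (@affine_path_continuous R p (plane_point R z) 0).
  by rewrite /= subr0 !mul1r !mul0r !addr0 -surjective_pairing.
move=> /nbhs_ballP[e /= e0 sub].
pose t := Num.min (e / 2) 1; have t0 : 0 < t by rewrite lt_min divr_gt0 //=.
exists (affine_path p (plane_point R z) t); split.
  by apply: shrink_to_center => //; rewrite t0 ge_min lexx orbT.
apply: sub; rewrite /ball /= sub0r normrN gtr0_norm //.
by rewrite gt_min; apply/orP; left; lra.
Qed.

Lemma frontier_open_cell z :
  frontier (open_cell (R := R) z) = closed_cell z `\` open_cell z.
Proof. by rewrite /frontier closure_open_cell (interior_id _).1 //; exact: open_cell_open. Qed.

Lemma connected_path (f : R -> R * R) (A : set R) : continuous f -> is_interval A ->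
  connected (f @` A).
Proof.
move=> fc Ai; apply: connected_continuous_connected.
  exact/connected_intervalP.
exact: continuous_subspaceT.
Qed.

Lemma open_cell_connected z : connected (open_cell (R := R) z).
Proof.
have seg p : open_cell z p -> plane_segment p (plane_point R z) `<=` open_cell z.
  move=> pz _ [t /= + <-]; rewrite in_itv /= le_eqVlt => /andP[/orP[/eqP <- _|t0 t1]].
    by rewrite subr0 !mul1r !mul0r !addr0 -surjective_pairing.
  by apply: shrink_to_center; [rewrite t0|exact: open_closed_cell].
rewrite (_ : open_cell z = \bigcup_(p in open_cell z) plane_segment p (plane_point R z)).
  apply: bigcup_connected.
    exists (plane_point R z) => p _; exists 1; first by rewrite /= in_itv /= ler01 lexx.
    by rewrite subrr !mul1r !mul0r !add0r -surjective_pairing.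
  move=> p _; apply: connected_path; first exact: affine_path_continuous.
  exact: interval_is_interval.
apply/seteqP; split=> [p pz|p [q qz pq]]; last exact: seg pq.
exists p => //; exists 0; first by rewrite /= in_itv /= ler01 lexx.
by rewrite subr0 !mul1r !mul0r !addr0 -surjective_pairing.
Qed.

Definition cell_side z (k : nat) : set (R * R) :=
  plane_segment (plane_point R (z + hexdir k)) (plane_point R (z + hexdir (k.+1 %% 6))).

Lemma cell_sideP z k p : cell_side z k p <-> exists2 t, 0 <= t <= 1 &
  coord_u p - z.1%:~R = (1 - t) * (hexdir k).1%:~R + t * (hexdir (k.+1 %% 6)).1%:~R /\
  coord_v p - z.2%:~R = (1 - t) * (hexdir k).2%:~R + t * (hexdir (k.+1 %% 6)).2%:~R.
Proof.
have E (t a b c : R) : (1 - t) * (a + b) + t * (a + c) = a + ((1 - t) * b + t * c) by ring.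
split=> [/plane_segmentP[t t01 [uE vE]]|[t t01 [uE vE]]].
  exists t => //; move: uE vE; rewrite /= !intrD !E => -> ->.
  by rewrite ![_ + _ - _]addrAC !subrr !add0r.
apply/plane_segmentP; exists t => //; rewrite /= !intrD !E -uE -vE.
by rewrite ![_ + (_ - _)]addrC !subrK.
Qed.

Lemma cell_boundaryP z p :
  (closed_cell z p /\ ~ open_cell z p) <-> exists k : 'I_6, cell_side z k p.
Proof.
split=> [[/and3P[/andP[u1 u2] /andP[v1 v2] /andP[w1 w2]]]|[k /cell_sideP[t /andP[t0 t1]]]].
  move=> /negP; rewrite /in_cell !lt_neqAle u1 u2 v1 v2 w1 w2 !andbT !negb_and !negbK.
  move: u1 u2 v1 v2 w1 w2.
  set u := coord_u p - _; set v := coord_v p - _ => u1 u2 v1 v2 w1 w2.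
  have side (k : 'I_6) t : 0 <= t <= 1 ->
      u = (1 - t) * (hexdir k).1%:~R + t * (hexdir (k.+1 %% 6)).1%:~R ->
      v = (1 - t) * (hexdir k).2%:~R + t * (hexdir (k.+1 %% 6)).2%:~R ->
      exists k : 'I_6, cell_side z k p.
    by move=> t01 uE vE; exists k; apply/cell_sideP; exists t.
  (* The six equations [u = -1], [u = 1], [v = -1], [v = 1], [u + v = -1],
     [u + v = 1] are those of the six sides. *)
  case/or3P => /orP[]/eqP E.
  - apply: (side (@Ordinal 6 2 isT) (1 - v)) => /=; rewrite ?mulrN1z; lra.
  - apply: (side (@Ordinal 6 5 isT) (1 + v)) => /=; rewrite ?mulrN1z; lra.
  - apply: (side (@Ordinal 6 4 isT) u) => /=; rewrite ?mulrN1z; lra.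
  - apply: (side (@Ordinal 6 1 isT) (- u)) => /=; rewrite ?mulrN1z; lra.
  - apply: (side (@Ordinal 6 3 isT) (- v)) => /=; rewrite ?mulrN1z; lra.
  - apply: (side (@Ordinal 6 0 isT) v) => /=; rewrite ?mulrN1z; lra.
rewrite /closed_cell /open_cell /in_cell /in_cell_closed /=.
set u := coord_u p - _; set v := coord_v p - _ => -[uE vE].
split.
  move: uE vE; case: k => -[|[|[|[|[|[|k]]]]]] //= _; rewrite ?mulrN1z => -> ->;
  by apply/and3P; split; apply/andP; split; lra.
apply/negP; rewrite !negb_and -!leNgt.
move: uE vE; case: k => -[|[|[|[|[|[|k]]]]]] //= _; rewrite ?mulrN1z => uE vE; apply/or3P.
- by constructor 3; apply/orP; right; lra.
- by constructor 2; apply/orP; right; lra.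
- by constructor 1; apply/orP; left; lra.
- by constructor 3; apply/orP; left; lra.
- by constructor 2; apply/orP; left; lra.
- by constructor 1; apply/orP; right; lra.
Qed.

Lemma coordK p : p = (coord_u p + coord_v p / 2, coord_v p * row_height R).
Proof.
by case: p => a b; rewrite /coord_u /coord_v /= subrK divfK ?lt0r_neq0 ?row_height_gt0.
Qed.

Lemma open_cell_bounded z : bounded_set (open_cell (R := R) z).
Proof.
pose B : R := `|z.1%:~R| + `|z.2%:~R| + 2 + (`|z.2%:~R| + 1) * row_height R.
exists B; split; first exact: num_real.
move=> M BM p /and3P[/andP[u1 u2] /andP[v1 v2] _].
have h0 := row_height_gt0 R.
have n1 := ler_norm (z.1%:~R : R); have n2 := ler_norm (- z.1%:~R : R).
have n3 := ler_norm (z.2%:~R : R); have n4 := ler_norm (- z.2%:~R : R).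
rewrite normrN in n2; rewrite normrN in n4.
have z0 := normr_ge0 (z.1%:~R : R); have z0' := normr_ge0 (z.2%:~R : R).
move: BM n1 n2 n3 n4 z0 z0' u1 u2 v1 v2; rewrite /B.
set z1 := z.1%:~R; set z2 := z.2%:~R; set N1 := `|z1|; set N2 := `|z2|.
move=> BM n1 n2 n3 n4 z0 z0' u1 u2 v1 v2.
have NH : 0 <= (N2 + 1) * row_height R by apply: mulr_ge0; [lra|exact: ltW].
rewrite /= [p]coordK prod_normE /= ge_max; apply/andP; split.
  by rewrite ler_norml; apply/andP; split; lra.
rewrite normrM (gtr0_norm h0); apply: le_trans (_ : (N2 + 1) * row_height R <= M).
  apply: ler_wpM2r; first exact: ltW.
  by rewrite ler_norml; apply/andP; split; lra.
by lra.
Qed.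

(** The open cell is relatively clopen in any set that avoids its sides, so it is
    a whole component. *)
Lemma component_open_cell z p (D : set (R * R)) : open_cell z p ->
  (forall k : 'I_6, cell_side z k `<=` D) -> open_cell z `<=` ~` D ->
  connected_component (~` D) p = open_cell z.
Proof.
move=> pz sides avoid; apply/seteqP; split; last first.
  exact: connected_component_max pz avoid (@open_cell_connected z).
move=> q [C [Cp CD Cc] Cq].
suff CE : C `&` open_cell z = C by move: Cq; rewrite -CE => -[].
  have clopen : C `&` open_cell z = C `&` closed_cell z.
    apply/seteqP; split=> x [Cx xz]; split=> //; first exact: open_closed_cell.
    apply: contrapT => nx; have /cell_boundaryP[k xk] := conj xz nx.
    by apply: (CD _ Cx); apply: sides xk.
apply: Cc; first by exists p.
  by exists (open_cell z) => //; exact: open_cell_open.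
by exists (closed_cell z) => //; exact: closed_cell_closed.
Qed.

Lemma unit_edge_avoids_cell z w y p : unit_step z w ->
  plane_segment (plane_point R z) (plane_point R w) p ->
  y != z -> y != w -> ~ open_cell y p.
Proof.
move=> zw ps yz yw py.
have [pz|pz] := pselect (p = plane_point R z).
  by move: py; rewrite pz => /plane_point_open_cell E; rewrite E eqxx in yz.
have [pw|pw] := pselect (p = plane_point R w).
  by move: py; rewrite pw => /plane_point_open_cell E; rewrite E eqxx in yw.
by have [E|E] := segment_point_near zw ps pz pw py; [move: yz|move: yw]; rewrite E eqxx.
Qed.

Lemma bounded_no_ray (A : set (R * R)) p (s : R) : s != 0 -> bounded_set A ->
  ~ (forall t : R, 0 <= t -> A (p.1, p.2 + s * t)).
Proof.
move=> s0 [B [_ bdA]] ray.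
pose M := `|B| + 1; have BM : B < M by rewrite ltr_pwDr // ler_norm.
pose t := (M + `|p.2| + 1) / `|s|.
have n0 : 0 < `|s| by rewrite normr_gt0.
have M0 : 0 < M by rewrite ltr_pwDr.
have t0 : 0 <= t by rewrite divr_ge0 // !addr_ge0 // ltW.
have := bdA _ BM _ (ray t t0); rewrite /= prod_normE /= ge_max => /andP[_].
have : `|s * t| = M + `|p.2| + 1.
  by rewrite normrM (ger0_norm t0) mulrC divfK // gt_eqF.
have := ler_normB (p.2 + s * t) p.2; rewrite addrC addKr.
lra.
Qed.

End CellTopology.

Section VerticalLines.
Variable R : realType.
Implicit Types (p : R * R) (z w : int * int).

(** The vertical direction is [(-1, 2)] in lattice coordinates; the factor makes a
    unit of [t] correspond to this vector. *)
Definition raise p (t : R) : R * R := (p.1, p.2 + (2 * row_height R) * t).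

Lemma raise_coord p t :
  coord_u (raise p t) = coord_u p - t /\ coord_v (raise p t) = coord_v p + 2 * t.
Proof.
have h0 := row_height_gt0 R.
by rewrite /coord_u /coord_v /=; split; field; exact: lt0r_neq0.
Qed.

(** A vertical line meets two neighbouring cells in intervals that touch on the
    common side. *)
Lemma between_neighbours z w p (s t : R) : 0 <= s -> 0 <= t ->
  w = z \/ w = z + (1, 1) \/ w = z + (2, -1) \/ z = w + (1, 1) \/ z = w + (2, -1) ->
  closed_cell z (raise p s) -> closed_cell w (raise p (- t)) ->
  closed_cell z p \/ closed_cell w p.
Proof.
move=> s0 t0 zw; rewrite /closed_cell /in_cell_closed /=.
have [-> ->] := raise_coord p s; have [-> ->] := raise_coord p (- t).
have [dx [dy [E1 E2 D]]] : exists dx dy : R, [/\ w.1%:~R = z.1%:~R + dx,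
   w.2%:~R = z.2%:~R + dy & (dx = 0 /\ dy = 0) \/ (dx = 1 /\ dy = 1) \/
   (dx = 2 /\ dy = -1) \/ (dx = -1 /\ dy = -1) \/ (dx = -2 /\ dy = 1)].
  case: zw => [->|[->|[->|[->|->]]]] /=.
  - exists 0, 0; rewrite !addr0; split=> //; by left.
  - exists 1, 1; rewrite !intrD; split=> //; by right; left.
  - exists 2, (-1); rewrite !intrD mulrN1z; split=> //; by do 2 right; left.
  - exists (-1), (-1); rewrite !intrD !addrK; split=> //; by do 3 right; left.
  - exists (-2), 1; rewrite !intrD mulrN1z addrK subrK; split=> //; by do 4 right.
rewrite E1 E2; move: (coord_u p) (coord_v p) (z.1%:~R : R) (z.2%:~R : R) => u v a b.
case/and3P => /andP[A1 A2] /andP[A3 A4] /andP[A5 A6].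
case/and3P => /andP[B1 B2] /andP[B3 B4] /andP[B5 B6].
move: D => [[? ?]|[[? ?]|[[? ?]|[[? ?]|[? ?]]]]]; subst dx dy.
- by left; apply/and3P; split; apply/andP; split; lra.
- by left; apply/and3P; split; apply/andP; split; lra.
(* The neighbour is below, and the common side separates the two cells. *)
- have [u1|u1] := lerP (u - a) 1.
    by left; apply/and3P; split; apply/andP; split; lra.
  by right; apply/and3P; split; apply/andP; split; lra.
- have [u1|u1] := lerP (-1) (u - a + (v - b)).
    by left; apply/and3P; split; apply/andP; split; lra.
  by right; apply/and3P; split; apply/andP; split; lra.
- by left; apply/and3P; split; apply/andP; split; lra.
Qed.
End VerticalLines.

(** * Faces of a hexagonal chain *)

Section ChainFaces.
Variables (R : realType) (dir : nat -> bool) (n : nat).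
Local Notation H := (chain_graph R dir n).
Local Notation T := (cell_vertex dir n).
Local Notation cc := (@cell_corner dir n).
Local Notation c i := (cell_center dir i).
Implicit Types (p : R * R).

Lemma chain_curve_side i (k : 'I_6) : (i < n.+1)%N ->
  @chain_curve R dir n (cc i k) (cc i (ordS k)) = cell_side (c i) k.
Proof. by move=> iN; rewrite /chain_curve /chain_position !val_cell_corner. Qed.

Lemma chain_drawingP p :
  drawing H p <-> exists i (k : 'I_6), (i < n.+1)%N /\ cell_side (c i) k p.
Proof.
split=> [[[x _ <-]|[x [y [/cell_adjP[i [k [iN E]]] pxy]]]]|[i [k [iN pk]]]].
- have [i [k [iN ->]]] := cell_vertexP x; exists i, k; split=> //.
  rewrite -chain_curve_side //; exists 0; first by rewrite /= in_itv /= lexx ler01.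
  by rewrite subr0 !mul1r !mul0r !addr0 -surjective_pairing.
- exists i, k; split=> //; rewrite -chain_curve_side //.
  by case: E pxy => -[-> ->] //; rewrite /= /chain_curve plane_segmentC.
right; exists (cc i k), (cc i (ordS k)); split; first exact: cell_adj_ordS.
by rewrite /= chain_curve_side.
Qed.

Lemma open_cell_off_drawing i : (i < n.+1)%N -> open_cell (c i) `<=` ~` drawing H.
Proof.
move=> iN p pi /chain_drawingP[j [k [jN pk]]].
have ne (l : nat) : (l < 6)%N -> c i != corner dir j l.
  by move=> l6; apply/eqP => E; have := corner_class dir j l6; rewrite -E cell_center_class.
apply: (unit_edge_avoids_cell (corner_step dir j k) pk _ _ pi); exact: ne.
Qed.

Lemma component_chain_cell i p : (i < n.+1)%N -> open_cell (c i) p ->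
  connected_component (~` drawing H) p = open_cell (c i).
Proof.
move=> iN pi; apply: component_open_cell => //; last exact: open_cell_off_drawing.
by move=> k q qk; apply/chain_drawingP; exists i, k.
Qed.

(** Vertically aligned points of two hexagons of the chain have the same
    value of [2 u + v], which differs by at most 2 from its value at either center. *)
Lemma closed_cells_neighbours i j p (s t : R) :
  closed_cell (c i) (raise p s) -> closed_cell (c j) (raise p t) ->
  c j = c i \/ c j = c i + (1, 1) \/ c j = c i + (2, -1) \/
  c i = c j + (1, 1) \/ c i = c j + (2, -1).
Proof.
rewrite /closed_cell /in_cell_closed /=.
have [-> ->] := raise_coord p s; have [-> ->] := raise_coord p t.
case/and3P => /andP[A1 A2] /andP[A3 A4] /andP[A5 A6].
case/and3P => /andP[B1 B2] /andP[B3 B4] /andP[B5 B6].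
have lev m : 2 * (c m).1%:~R + (c m).2%:~R = 3 * (m%:Z)%:~R :> R.
  rewrite -[2]/(2%:~R) -[3]/(3%:~R) -!intrM -intrD; congr _%:~R.
  exact: cell_center_level.
have li := lev i; have lj := lev j.
have ij : i%:Z%:~R - j%:Z%:~R < 2%:~R :> R by lra.
have ji : j%:Z%:~R - i%:Z%:~R < 2%:~R :> R by lra.
rewrite -intrB ltr_int in ij; rewrite -intrB ltr_int in ji.
have [<-|[->|->]] : i = j \/ j = i.+1 \/ i = j.+1 by clear -ij ji; lia.
- by left.
- by right; rewrite /=; case: (dir i.+1); [left|right; left].
- by do 3 right; rewrite /=; case: (dir j.+1); [left|right].
Qed.

(** If both vertical rays from [p] met the chain, the point [p] would lie between
    two vertically aligned points of equal or neighbouring hexagons, hence in one of them. *)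
Lemma chain_escape p : (forall i, (i < n.+1)%N -> ~ closed_cell (c i) p) ->
  exists2 s : R, s != 0 & forall t, 0 <= t -> forall i, (i < n.+1)%N ->
    ~ closed_cell (c i) (p.1, p.2 + s * t).
Proof.
move=> out; have h0 := row_height_gt0 R.
have [up|] := pselect (forall t, 0 <= t -> forall i, (i < n.+1)%N ->
    ~ closed_cell (c i) (raise p t)).
  by exists (2 * row_height R) => //; rewrite mulf_neq0 ?gt_eqF.
move/existsNP => [s /not_implyP[s0 /existsNP[i /not_implyP[iN /contrapT si]]]].
exists (- (2 * row_height R)); first by rewrite oppr_eq0 mulf_neq0 ?gt_eqF.
move=> t t0 j jN; rewrite mulNr -mulrN => tj.
have [] := between_neighbours s0 t0 (closed_cells_neighbours si tj) si tj.
  exact: out.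
exact: out.
Qed.

(** A point outside all closed hexagons starts a vertical ray in the
    complement of the drawing, so its component is unbounded. *)
Lemma chain_interior_faceP F :
  interior_face H F <-> exists2 i, (i < n.+1)%N & F = open_cell (c i).
Proof.
split=> [[[p pD ->] bd]|[i iN ->]].
  have [[i [iN pi]]|none] := pselect (exists i, (i < n.+1)%N /\ open_cell (c i) p).
    by exists i => //; exact: component_chain_cell.
  have out i : (i < n.+1)%N -> ~ closed_cell (c i) p.
    move=> iN pi; have npi : ~ open_cell (c i) p by move=> pi'; apply: none; exists i.
    have /cell_boundaryP[k pk] := conj pi npi.
    by apply: pD; apply/chain_drawingP; exists i, k.
  have [s s0 ray] := chain_escape out; exfalso.
  apply: (bounded_no_ray s0 bd (p := p)) => t t0.
  pose A := (fun t : R => (p.1, p.2 + s * t)) @` [set t | 0 <= t].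
  suff : A `<=` connected_component (~` drawing H) p by apply; exists t.
  apply: connected_component_max.
  - by exists 0; rewrite /= ?lexx // mulr0 addr0 -surjective_pairing.
  - move=> _ [r /= r0 <-] /chain_drawingP[i [k [iN rk]]].
    apply: (ray r r0 i iN).
    by have /cell_boundaryP[] : exists k : 'I_6, cell_side (c i) k (p.1, p.2 + s * r)
      by exists k.
  apply: connected_path.
    have cont2 : continuous (fun t : R => p.2 + s * t).
      by move=> r; apply: cvgD; [exact: cvg_cst|apply: cvgMl_tmp; exact: cvg_id].
    have cont1 : continuous (fun _ : R => p.1) by move=> r; exact: cvg_cst.
    by move=> r; exact: (cvg_pair (cont1 r) (cont2 r)).
  by move=> x y x0 y0 z /andP[xz _]; exact: le_trans x0 xz.
split; last exact: open_cell_bounded.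
exists (plane_point R (c i)); last first.
  by rewrite (component_chain_cell iN) //; exact: open_cell_point.
by apply: (open_cell_off_drawing iN); exact: open_cell_point.
Qed.

Lemma frontier_chain_cell i : (i < n.+1)%N ->
  frontier (open_cell (R := R) (c i)) =
  \bigcup_(k in [set: 'I_6]) @chain_curve R dir n (cc i k) (cc i (ordS k)).
Proof.
move=> iN; rewrite frontier_open_cell; apply/seteqP; split=> p.
  by move/cell_boundaryP => [k pk]; exists k => //; rewrite chain_curve_side.
by case=> k _; rewrite chain_curve_side // => pk; apply/cell_boundaryP; exists k.
Qed.

Lemma chain_cell_regular i : (i < n.+1)%N ->
  @regular_unit_hexagon R H (cc i).
Proof.
move=> iN; exists (plane_point R (c i)), 0 => k; split.
- rewrite /= /chain_position val_cell_corner // /corner plane_pointD.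
  by rewrite (hexagon_position R k) add0r.
- exact: cell_adj_ordS.
- by [].
Qed.

Lemma chain_cell_bounded_by i : (i < n.+1)%N ->
  @bounded_by R H (open_cell (c i)) (cc i).
Proof.
by move=> iN; split; [exact: chain_cell_regular|exact: frontier_chain_cell].
Qed.

Lemma chain_hexagonal_system : hexagonal_system H.
Proof.
split; first exact: cell_connected_graph.
  by move=> v; exact: cell_no_cut_vertex.
by move=> F /chain_interior_faceP[i iN ->]; exists (cc i); exact: chain_cell_bounded_by.
Qed.

Lemma edge_midpoint (x y : T) : cell_adj x y -> exists p,
  [/\ @chain_curve R dir n x y p, p <> @chain_position R dir n x & p <> @chain_position R dir n y].
Proof.
move=> xy; have xNy : plane_point R (val x) <> plane_point R (val y).
  by move/plane_point_inj/val_inj => E; rewrite E cell_adj_irr in xy.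
pose p := affine_path (plane_point R (val x)) (plane_point R (val y)) (1 / 2).
exists p; split; first by exists (1 / 2) => //; rewrite /= in_itv /=; apply/andP; split; lra.
  rewrite /p /chain_position /affine_path; move: xNy.
  case: (plane_point _ _) (plane_point _ _) => [a b] [a' b'] /= ne [E1 E2].
  by apply: ne; congr (_, _); lra.
rewrite /p /chain_position /affine_path; move: xNy.
case: (plane_point _ _) (plane_point _ _) => [a b] [a' b'] /= ne [E1 E2].
by apply: ne; congr (_, _); lra.
Qed.

Lemma chain_edge_determined (x y z w : T) p : cell_adj x y -> cell_adj z w ->
  @chain_curve R dir n x y p -> p <> @chain_position R dir n x -> p <> @chain_position R dir n y ->
  @chain_curve R dir n z w p -> ([set x; y] = [set z; w])%SET.
Proof.
move=> xy zw pxy px py pzw.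
have := unit_edge_determined (cell_adj_step xy) (cell_adj_step zw) pxy px py pzw.
by case=> -[/val_inj -> /val_inj ->] //; rewrite finset.setUC.
Qed.

(** Although [v] may list the vertices from any starting point, its edges are determined
    by the face: each of them has an interior point on the frontier, and that point determines
    the edge. *)
Lemma chain_hexagon_edges i (v : 'I_6 -> H) : (i < n.+1)%N ->
  bounded_by (open_cell (c i)) v -> hexagon_edges v = cell_edges dir n i.
Proof.
move=> iN [[c0 [th reg]] fr].
have adj_v k : cell_adj (v k) (v (ordS k)) by have [_ a _] := reg k.
move: fr; rewrite frontier_chain_cell // => fr.
apply/setP => e; apply/imsetP/imsetP => -[k _ ->].
  have [p [pk p1 p2]] := edge_midpoint (adj_v k).
  have : (\bigcup_(k in [set: 'I_6]) @chain_curve R dir n (cc i k) (cc i (ordS k))) p.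
    by rewrite fr; exists k.
  case=> l _ pl; exists l => //.
  exact: (chain_edge_determined (adj_v k) (cell_adj_ordS dir l iN) pk p1 p2 pl).
have al := cell_adj_ordS dir k iN.
have [p [pk p1 p2]] := edge_midpoint al.
have : (\bigcup_(k in [set: 'I_6]) curve (v k) (v (ordS k))) p.
  by rewrite -fr; exists k.
case=> l _ pl; exists l => //.
exact: (chain_edge_determined al (adj_v l) pk p1 p2 pl).
Qed.

Lemma chain_hexagons :
  hexagons H = [set cell_edges dir n (val i) | i : 'I_n.+1]%SET.
Proof.
apply/setP => h; rewrite inE; apply/asboolP/imsetP.
  case=> F [v [/chain_interior_faceP[i iN ->] bd ->]].
  by exists (Ordinal iN) => //; exact: chain_hexagon_edges.
case=> i _ ->; exists (open_cell (c i)), (cc i); split=> //.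
- by apply/chain_interior_faceP; exists (val i); rewrite // ltn_ord.
- by apply: chain_cell_bounded_by; exact: ltn_ord.
Qed.

End ChainFaces.

(** * Density of the zeros *)

Lemma chain_sextet_polynomial (R : realType) (dir : nat -> bool) (n : nat) (x : R) :
  (sextet_polynomial (chain_graph R dir n)).[x] =
  (weights x (turn dir) n.+1).1 + (weights x (turn dir) n.+1).2.
Proof.
rewrite -(sum_resonant (cell_chain dir n)) -sum_resonant_count.
rewrite /sextet_polynomial /clar_number chain_hexagons horner_sum.
by apply: eq_bigr => k _; rewrite hornerZ hornerXn.
Qed.

(** The step changes direction after every [m.+1] hexagons. *)
Definition zigzag (m i : nat) : bool := odd (i %/ m.+1).

Lemma turn_zigzag m : turn (zigzag m) = period_kink m.
Proof.
apply/funext => i; rewrite /turn /zigzag /period_kink.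
have [/dvdnP[k E]|ndv] := boolP (m.+1 %| i.+1)%N.
  have -> : (i %/ m.+1 = k.-1)%N by nia.
  rewrite E mulnK //; case: k E => // k _ /=; by case: (odd k).
suff -> : (i.+1 %/ m.+1 = i %/ m.+1)%N by rewrite eqxx.
by rewrite divnS // (negPf ndv).
Qed.

Lemma sextet_zero_weights (R : realType) (x : R) m n : (2 <= n)%N ->
  (weights x (period_kink m) (n * m.+1)).1 = 0 -> sextet_zero x.
Proof.
case: n => // n n2 E.
have [l lE] : exists l, (n.+1 * m.+1).-1 = l.+1 by exists (n.+1 * m.+1).-2; nia.
exists (chain_graph R (zigzag m) l); split.
- exact: chain_hexagonal_system.
- exact: (chain_perfect_matching (cell_chain (zigzag m) l)).
- by rewrite chain_sextet_polynomial turn_zigzag -lE weights_total.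
Qed.

Theorem theorem3p8 (R : realType) :
  `]-oo, (0 : R)] `<=` closure ([set r : R | sextet_zero r] `&` `]-oo, (0 : R)]).
Proof.
move=> r; rewrite /= in_itv /= => r0 B /nbhs_ballP[e /= e0 eB].
have al0 : 0 <= Num.sqrt (- r) by exact: sqrtr_ge0.
have albe : Num.sqrt (- r) < Num.sqrt (- r + e) by rewrite ltr_sqrt; lra.
have [s [m [n [sl su n2 zero]]]] := weights_zeros_dense al0 albe.
have s0 : 0 < s by apply: le_lt_trans sl.
have sl2 : - r < s ^+ 2.
  by rewrite -[- r]sqr_sqrtr ?oppr_ge0 // ltr_pXn2r ?nnegrE // ltW.
have su2 : s ^+ 2 < - r + e.
  rewrite -[- r + e]sqr_sqrtr; last by lra.
  by rewrite ltr_pXn2r ?nnegrE ?ltW // (lt_trans s0).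
exists (- s ^+ 2); split; last by apply: eB; rewrite /ball /= ger0_norm; lra.
split; first exact: sextet_zero_weights zero.
by rewrite /= in_itv /= oppr_le0 sqr_ge0.
Qed.
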